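(* Let $(F,\delta)$ be a differential field of characteristic zero containing $x$ with $\delta(x)=1$, whose constant field $C_F$ is algebraically closed. Let $(F(t),\delta)$ be a monomial extension of $(F,\delta)$ whose constant field equals $C_F$. If $f\in F(t)$ is stable over the elementary extensions of $F(t)$, then there exists $g\in F(t)$ such that $f-\delta(g)$ is reduced.
   Context: A differential field is a field with an additive map $\delta$ satisfying the Leibniz rule. $(F(t),\delta)$ is a monomial extension of $(F,\delta)$ if $t$ is transcendental over $F$, the derivation extends that of $F$, and $\delta(t)\in F[t]$. A polynomial $p\in F[t]$ is special if $\gcd(p,\delta(p))=p$; a rational function in $F(t)$ is reduced if its denominator (in lowest terms) is special. For a differential extension $E\supseteq k$, $t\in E$ is elementary over $k$ if it is algebraic over $k$, or $t\neq0$ and $\delta(t)/t=\delta(a)$ for some $a\in k$, or $\delta(t)=\delta(a)/a$ for some $a\in k\setminus\{0\}$; $E$ is an elementary extension of $k$ if $E=k(t_1,\dots,t_n)$ with each $t_i$ elementary over $k(t_1,\dots,t_{i-1})$. An element $f$ of a differential field $K$ is stable over the elementary extensions of $K$ if there is a sequence $(g_i)_{i\in\mathbb{N}}$ such that each $g_i$ lies in some elementary extension of $K$ and $f=\delta^i(g_i)$ for all $i\in\mathbb{N}$. *)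

(* Defs.v *)
From HB Require Import structures.
From mathcomp Require Import all_boot all_order all_algebra.
From mathcomp Require Import fraction.
Set Implicit Arguments. Unset Strict Implicit. Unset Printing Implicit Defensive.
Import GRing.Theory.
Local Open Scope ring_scope.

Definition is_derivation (R : nzRingType) (d : R -> R) : Prop :=
  (forall x y, d (x + y) = d x + d y) /\ (forall x y, d (x * y) = d x * y + x * d y).

Notation ratfun F := {fraction {poly F}}.
Definition rf (F : fieldType) (p : {poly F}) : ratfun F := FracField.tofrac p.

Definition constants_alg_closed (F : fieldType) (d : F -> F) : Prop :=
  forall p : {poly F}, (forall i, d p`_i = 0) -> (1 < size p)%N ->
    exists c, d c = 0 /\ root p c.

(* (F(t), D) is a monomial extension of (F, d): D is a derivation on F(t)
   extending d, and D t lies in F[t].  (t = 'X is transcendental over F.) *)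
Definition monomial_ext (F : fieldType) (d : F -> F) (D : ratfun F -> ratfun F) : Prop :=
  is_derivation D /\
  (forall c : F, D (rf c%:P) = rf (d c)%:P) /\
  exists a : {poly F}, D (rf 'X) = rf a.

Definition same_constants (F : fieldType) (d : F -> F) (D : ratfun F -> ratfun F) : Prop :=
  forall u, D u = 0 -> exists c : F, d c = 0 /\ u = rf c%:P.

Definition special (F : fieldType) (D : ratfun F -> ratfun F) (p : {poly F}) : Prop :=
  exists q : {poly F}, D (rf p) = rf q /\ gcdp p q %= p.

Definition reduced (F : fieldType) (D : ratfun F -> ratfun F) (f : ratfun F) : Prop :=
  exists a b : {poly F}, b != 0 /\ coprimep a b /\ f = rf a / rf b /\ special D b.

Inductive gen_field (E : fieldType) (A : E -> Prop) : E -> Prop :=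
  | gen_base x : A x -> gen_field A x
  | gen_add x y : gen_field A x -> gen_field A y -> gen_field A (x + y)
  | gen_opp x : gen_field A x -> gen_field A (- x)
  | gen_one : gen_field A 1
  | gen_mul x y : gen_field A x -> gen_field A y -> gen_field A (x * y)
  | gen_inv x : gen_field A x -> gen_field A x^-1.

Definition elementary_over (E : fieldType) (dE : E -> E) (k : E -> Prop) (t : E) : Prop :=
  (exists p : {poly E}, p != 0 /\ (forall i, k p`_i) /\ root p t)
  \/ (t != 0 /\ exists a, k a /\ dE t / t = dE a)
  \/ (exists a, k a /\ a != 0 /\ dE t = dE a / a).

Definition elementary_ext (K : fieldType) (dK : K -> K)
    (E : fieldType) (dE : E -> E) (iota : {rmorphism K -> E}) : Prop :=
  is_derivation dE /\ (forall a, dE (iota a) = iota (dK a)) /\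
  exists ts : seq E,
    (forall i, (i < size ts)%N ->
       elementary_over dE
         (gen_field (fun y => (exists a, y = iota a) \/ y \in take i ts)) (nth 0 ts i))
    /\ (forall y, gen_field (fun y => (exists a, y = iota a) \/ y \in ts) y).

Definition stable_elem (K : fieldType) (dK : K -> K) (f : K) : Prop :=
  exists g : forall i : nat,
      { E : fieldType & { dE : E -> E & { iota : {rmorphism K -> E} & E } } },
    forall i,
      let: existT E (existT dE (existT iota gi)) := g i in
      elementary_ext dK dE iota /\ iota f = iter i dE gi.

(* Main.v *)
Require Import Defs.
From HB Require Import structures.
From mathcomp Require Import all_boot all_order all_algebra.
From mathcomp Require Import fraction generic_quotient ring zify boolp.
Set Implicit Arguments. Unset Strict Implicit. Unset Printing Implicit Defensive.
Import GRing.Theory.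
Local Open Scope ring_scope.

(**
If [f = δ^(m+1) g] with [g] in an elementary extension [E] of [K = F(t)], then
integration by parts shows that [x^k f] has an integral in [E] for all [k <= m].
Let [C] be the field of constants of [E]. Liouville's theorem, descended along
the tower from [E] to [K(C)], writes [x^k f] as [δv + Σ c_i δu_i/u_i] with
[v, u_i] in [K(C)] and constants [c_i]. Constants of [E] are linearly disjoint
from [K] over the constants of [K], so [K(C)] is the rational function field
[F(C)(t)]. Let [Q] be a factor over [F(C)] of a normal irreducible [P]. At [Q],
every element has a residue (the coefficient of [δQ/Q] after Hermite
reduction), and the residue [e_k] of [x^k f] is a constant. If [f] has a pole of
order at most [m] at [Q], then [Σ (-1)^k 'C(m, k) x^(m-k) e_k = 0], because,
in a completion where [x - x_0] is a local parameter with [x_0] constant, this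
is the residue of [(x_0 - x)^m f]. As [x] is transcendental over [C], the
leading coefficient [e_0] vanishes: [f] has no residue at [P], so the simple part
left by Hermite reduction of [f] is regular at every normal [P].
*)

(** * Derivations on rings and fields *)

Section DerivationTheory.
Variables (R : nzRingType) (d : R -> R).
Hypothesis hd : is_derivation d.

Lemma derD x y : d (x + y) = d x + d y. Proof. exact: hd.1. Qed.
Lemma derM x y : d (x * y) = d x * y + x * d y. Proof. exact: hd.2. Qed.

Lemma der0 : d 0 = 0.
Proof. by apply: (addrI (d 0)); rewrite -derD !addr0. Qed.

Lemma der1 : d 1 = 0.
Proof. by apply: (addrI (d 1)); rewrite addr0 -{3}[1]mulr1 derM mulr1 mul1r. Qed.

Lemma derN x : d (- x) = - d x.
Proof. by apply: (addrI (d x)); rewrite -derD !subrr der0. Qed.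

Lemma derB x y : d (x - y) = d x - d y. Proof. by rewrite derD derN. Qed.

Lemma der_sum I (r : seq I) P (f : I -> R) :
  d (\sum_(i <- r | P i) f i) = \sum_(i <- r | P i) d (f i).
Proof. exact: (big_morph d derD der0). Qed.

Lemma der_nat n : d n%:R = 0.
Proof. by elim: n => [|n IH]; rewrite ?der0 // -natr1 derD IH der1 addr0. Qed.

End DerivationTheory.

Section DerivationComTheory.
Variables (R : comNzRingType) (d : R -> R).
Hypothesis hd : is_derivation d.

Lemma derX x n : d (x ^+ n.+1) = n.+1%:R * x ^+ n * d x.
Proof.
elim: n => [|n IH]; first by rewrite expr1 expr0 mulr1 mul1r.
by rewrite exprS (derM hd) IH !exprS; ring.
Qed.

End DerivationComTheory.

Section DerivationFieldTheory.
Variables (E : fieldType) (d : E -> E).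
Hypothesis hd : is_derivation d.

Lemma derV x : x != 0 -> d x^-1 = - d x / (x * x).
Proof.
move=> x0; apply: (mulfI x0); have := derM hd x x^-1.
rewrite mulfV // (der1 hd) => /esym /eqP; rewrite addr_eq0 => /eqP h.
by rewrite -[LHS]opprK -h; field.
Qed.

Lemma der_div x y : y != 0 -> d (x / y) = (d x * y - x * d y) / (y * y).
Proof. by move=> y0; rewrite (derM hd) (derV y0); field. Qed.

Lemma dlogM x y : x != 0 -> y != 0 -> d (x * y) / (x * y) = d x / x + d y / y.
Proof. by move=> x0 y0; rewrite (derM hd); field; rewrite x0 y0. Qed.

Lemma dlogV x : x != 0 -> d x^-1 / x^-1 = - (d x / x).
Proof. by move=> x0; rewrite (derV x0); field; rewrite x0 oner_neq0. Qed.

Lemma dlogX x n : x != 0 -> d (x ^+ n) / x ^+ n = n%:R * (d x / x).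
Proof.
move=> x0; elim: n => [|n IH]; first by rewrite (der1 hd) !mul0r.
by rewrite exprS dlogM ?expf_neq0 // IH; ring.
Qed.

End DerivationFieldTheory.

(** * Irreducible polynomials over a field *)

Section Irreducible.
Variable k : fieldType.
Implicit Types p q P Q : {poly k}.

Lemma size_ltn_mul p q : (1 < size p)%N -> q != 0 -> (size q < size (p * q)%R)%N.
Proof.
move=> sp q0; have p0 : p != 0 by rewrite -size_poly_gt0 (ltn_trans _ sp).
by rewrite size_mul //; case: (size p) sp => [|[|s]] // _; rewrite !addSn /= ltnS leq_addl.
Qed.

Lemma irredp_coprime P q : irreducible_poly P -> ~~ (P %| q) -> coprimep P q.
Proof.
move=> irrP; apply: contraNT => nco.
have: gcdp P q %= P by apply: irrP.2; rewrite ?dvdp_gcdl.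
by move=> /eqp_dvdl <-; rewrite dvdp_gcdr.
Qed.

Lemma irredp_dvdM P p q : irreducible_poly P ->
  ~~ (P %| p) -> ~~ (P %| q) -> ~~ (P %| p * q).
Proof. by move=> irrP np nq; rewrite Gauss_dvdpr // irredp_coprime. Qed.

Lemma irredp_factor p : (1 < size p)%N ->
  exists P, irreducible_poly P /\ P %| p.
Proof.
have [n] := ubnP (size p); elim: n p => // n IH p; rewrite ltnS => szp sz1.
have [irr|nirr] := pselect (irreducible_poly p); first by exists p.
have [q [szq qp nqp]] : exists q, [/\ size q != 1%N, q %| p & ~~ (q %= p)].
  apply: contrapT => h; apply: nirr; split=> // q szq qp.
  by apply: contrapT => /negP nqp; apply: h; exists q.
have p0 : p != 0 by rewrite -size_poly_gt0 (ltn_trans _ sz1).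
have q0 : q != 0 by apply: contraNneq p0 => q0; move: qp; rewrite q0 dvd0p.
have ltqp : (size q < size p)%N.
  by rewrite ltn_neqAle dvdp_leq // andbT; move: nqp; rewrite -(dvdp_size_eqp qp).
have [||P [irrP Pq]] := IH q; first exact: leq_trans szp.
  by rewrite ltn_neqAle eq_sym szq size_poly_gt0.
by exists P; split=> //; apply: dvdp_trans qp.
Qed.

Lemma irredp_mult P p : irreducible_poly P -> p != 0 ->
  exists n q, ~~ (P %| q) /\ p = P ^+ n * q.
Proof.
move=> irrP; have [m] := ubnP (size p); elim: m p => // m IH p.
rewrite ltnS => szp p0.
have [/dvdpP [q Dp]|nPp] := boolP (P %| p); last by exists 0, p; rewrite mul1r.
have P0 := irredp_neq0 irrP.
have q0 : q != 0 by apply: contraNneq p0 => q0; rewrite Dp q0 mul0r.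
have [|n [r [nr Dq]]] := IH q _ q0.
  by apply: leq_trans szp; rewrite Dp mulrC size_ltn_mul // irrP.1.
by exists n.+1, r; split=> //; rewrite Dp Dq exprS mulrC mulrA.
Qed.

End Irreducible.

(** * Fractions, local rings and Liouville forms inside an ambient field *)

Definition fracs (k E : fieldType) (ev : {poly k} -> E) (y : E) : Prop :=
  exists p q, q != 0 /\ y = ev p / ev q.

(** For [ev] injective and [Q] irreducible, this is the localisation of [k[X]] at [(Q)], a discrete
    valuation ring, seen inside [E]. *)
Definition locring (k E : fieldType) (ev : {poly k} -> E) (Q : {poly k}) (y : E) : Prop :=
  exists p q, ~~ (Q %| q) /\ y = ev p / ev q.

(** The constants [c] range over all of [E], not only over [K]. Fields are predicates on [E], so
    that all stages of a tower share one derivation. *)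
Inductive liouville (E : fieldType) (d : E -> E) (K : E -> Prop) : E -> Prop :=
  | liouville_der v : K v -> liouville d K (d v)
  | liouville_dlog c u : d c = 0 -> K u -> u != 0 -> liouville d K (c * (d u / u))
  | liouville_add y z : liouville d K y -> liouville d K z -> liouville d K (y + z).

(* [altsum x m r] is the sum of (-1)^k 'C(m, k) x^(m-k) r_k over k <= m. *)
Fixpoint altsum (R : pzRingType) (x : R) m (r : nat -> R) : R :=
  if m is m'.+1 then x * altsum x m' r - altsum x m' (fun k => r k.+1) else r 0%N.

(** * Alternating binomial sums *)

Section AltSum.
Variables (R : comNzRingType) (x : R).

Lemma altsumS m r : altsum x m.+1 r = x * altsum x m r - altsum x m (fun k => r k.+1).
Proof. by []. Qed.

Lemma eq_altsum m r s : (forall k, (k <= m)%N -> r k = s k) -> altsum x m r = altsum x m s.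
Proof.
elim: m r s => [|m IH] r s e /=; first exact: e.
by rewrite (IH r s) 1?(IH (fun k => r k.+1) (fun k => s k.+1)) // => k km; apply: e => //; exact: leqW.
Qed.

Lemma altsumD m r s : altsum x m (fun k => r k + s k) = altsum x m r + altsum x m s.
Proof. by elim: m r s => //= m IH r s; rewrite IH (IH (fun k => r k.+1)); ring. Qed.

Lemma altsumMl a m r : altsum x m (fun k => a * r k) = a * altsum x m r.
Proof. by elim: m r => //= m IH r; rewrite IH (IH (fun k => r k.+1)); ring. Qed.

(** By the binomial theorem the sum is [a (x - x)^(m+1)]. *)
Lemma altsum_geom m a : altsum x m.+1 (fun k => x ^+ k * a) = 0.
Proof.
rewrite /= -altsumMl; apply/eqP; rewrite subr_eq0; apply/eqP/eq_altsum => k _.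
by rewrite exprS mulrA.
Qed.

(** Rests on [k 'C(m+1, k) = (m+1) 'C(m, k-1)], the sign coming from the shift of index. At [k = 0]
    the factor [k%:R] kills the spurious value [s 0]. *)
Lemma altsum_diff m s : altsum x m.+1 (fun k => k%:R * s k.-1) = - (m.+1%:R * altsum x m s).
Proof.
elim: m s => [|m IH] s; first by rewrite /=; ring.
set a := fun k => _; rewrite altsumS IH.
have -> : altsum x m.+1 (fun k => a k.+1) =
    altsum x m.+1 (fun k => k%:R * s k.-1.+1) + altsum x m.+1 s.
  by rewrite -altsumD; apply: eq_altsum => -[|k] _; rewrite /a /= -?natr1; ring.
by rewrite (IH (fun k => s k.+1)) /= -(natr1 m.+1); ring.
Qed.

Variable d : R -> R.
Hypothesis hd : is_derivation d.
Hypothesis dx : d x = 1.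

(** With [e_k] read as a symbolic power [e^k], the sum is [(x - e)^(m+1)], differentiated with [e]
    constant. *)
Lemma der_altsum m e : (forall k, d (e k) = 0) ->
  d (altsum x m.+1 e) = m.+1%:R * altsum x m e.
Proof.
elim: m e => [|m IH] e de.
  by rewrite /= (derB hd) (derM hd) dx !de; ring.
by rewrite altsumS (derB hd) (derM hd) dx IH // (IH (fun k => e k.+1)) //= -(natr1 m.+1); ring.
Qed.

End AltSum.

(** Differentiating [m] times leaves [m! e_0], and the factorial is nonzero. *)
Lemma altsum_const_eq0 (R : idomainType) (d : R -> R) (x : R) m e :
  is_derivation d -> (forall n, n.+1%:R != 0 :> R) -> d x = 1 ->
  (forall k, d (e k) = 0) -> altsum x m e = 0 -> e 0%N = 0.
Proof.
move=> hd char0 dx de; elim: m => [//|m IH] /(congr1 d).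
rewrite (der0 hd) (der_altsum hd) // => /eqP; rewrite mulf_eq0.
by rewrite (negPf (char0 m)) => /eqP /IH.
Qed.

(** * Hermite reduction and residues at an irreducible polynomial *)

Section Local.
Variables (k E : fieldType) (ev : {rmorphism {poly k} -> E}).
Variables (d : E -> E) (D : {poly k} -> {poly k}).
Hypothesis ev_inj : injective ev.
Hypothesis hd : is_derivation d.
Hypothesis d_ev : forall p, d (ev p) = ev (D p).
Hypothesis char0 : forall n, n.+1%:R != 0 :> E.

Lemma ev_eq0 p : (ev p == 0) = (p == 0).
Proof. by rewrite -(rmorph0 ev) (inj_eq ev_inj). Qed.

Lemma der_lift : is_derivation D.
Proof.
by split=> p q; apply: ev_inj; rewrite ?rmorphD ?rmorphM -!d_ev ?rmorphD ?rmorphM ?(derD hd) ?(derM hd).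
Qed.

Variable Q : {poly k}.
Hypothesis irrQ : irreducible_poly Q.
Local Notation O := (locring ev Q).
Local Notation q := (ev Q).

Let ndvd0 p : ~~ (Q %| p) -> ev p != 0.
Proof. by rewrite ev_eq0; apply: contraNneq => ->; rewrite dvdp0. Qed.

Let q0 : q != 0. Proof. by rewrite ev_eq0 irredp_neq0. Qed.

Let Q1 : ~~ (Q %| 1).
Proof. by rewrite dvdp1 neq_ltn irrQ.1 orbT. Qed.

Lemma loc_ev p : O (ev p).
Proof. by exists p, 1; rewrite rmorph1 divr1. Qed.

Lemma loc_evV p : ~~ (Q %| p) -> O (ev p)^-1.
Proof. by exists 1, p; rewrite rmorph1 div1r. Qed.

Lemma locM y z : O y -> O z -> O (y * z).
Proof.
move=> [p1 [q1 [n1 ->]]] [p2 [q2 [n2 ->]]]; exists (p1 * p2), (q1 * q2).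
by split; [exact: irredp_dvdM | rewrite !rmorphM mulf_div].
Qed.

Lemma locD y z : O y -> O z -> O (y + z).
Proof.
move=> [p1 [q1 [n1 ->]]] [p2 [q2 [n2 ->]]]; exists (p1 * q2 + p2 * q1), (q1 * q2).
split; first exact: irredp_dvdM.
by rewrite rmorphD !rmorphM addf_div // ndvd0.
Qed.

Lemma locN y : O y -> O (- y).
Proof. by move=> [p [r [n ->]]]; exists (- p), r; rewrite rmorphN mulNr. Qed.

Lemma locB y z : O y -> O z -> O (y - z).
Proof. by move=> Oy Oz; apply: locD => //; apply: locN. Qed.

Lemma loc0 : O 0. Proof. by rewrite -(rmorph0 ev); exact: loc_ev. Qed.
Lemma loc_nat n : O n%:R. Proof. by rewrite -(rmorph_nat ev); exact: loc_ev. Qed.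
Lemma locX y n : O y -> O (y ^+ n).
Proof.
by move=> Oy; elim: n => [|n IH]; [exact: (loc_nat 1) | rewrite exprS; apply: locM].
Qed.

Lemma loc_natV n : O (n.+1%:R)^-1.
Proof.
rewrite -(rmorph_nat ev); apply: loc_evV.
have nz: (n.+1%:R : k) != 0.
  apply: contraNneq (char0 n) => h.
  by rewrite -(rmorph_nat ev) -polyC_natr h rmorph0.
apply: contraNN Q1 => h; apply: dvdp_trans h _.
rewrite -polyC_natr; have -> : (1 : {poly k}) = n.+1%:R%:P * (n.+1%:R^-1)%:P.
  by rewrite -polyCM divff.
exact: dvdp_mulr.
Qed.

Lemma loc_der y : O y -> O (d y).
Proof.
move=> [p [r [n ->]]]; rewrite (der_div hd) ?ndvd0 // !d_ev -!rmorphM -rmorphB.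
by apply: locM; [exact: loc_ev | apply: loc_evV; apply: irredp_dvdM].
Qed.

Lemma loc_ev_dvd p y : O y -> ev p = q * y -> Q %| p.
Proof.
move=> [p' [r [n ->]]] h.
have /ev_inj Dp : ev (r * p) = ev (Q * p').
  by rewrite !rmorphM h; field; exact: ndvd0.
by rewrite -(Gauss_dvdpr _ (irredp_coprime irrQ n)) Dp dvdp_mulr.
Qed.

Hypothesis nQ : ~~ (Q %| D Q).

Let Oq : O q. Proof. exact: loc_ev. Qed.
Let dq0 : d q != 0. Proof. by rewrite d_ev ndvd0. Qed.
Let OdqV : O (d q)^-1. Proof. by rewrite d_ev; exact: loc_evV. Qed.

(** A pole of order [n+1] of [v] would give [d v] a pole of order [n+2], since [d q] and [n+1] are
    units at [Q]. Solving the Leibniz rule for [q^(n+1) v] lowers the bound on the pole by one. *)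
Lemma loc_max_der_pole n v z : O (q ^+ n * v) -> O z -> q * d v = z -> O v.
Proof.
elim: n => [|n IH]; first by rewrite expr0 mul1r.
move=> Ow Oz dv; apply: IH (Oz) (dv).
set w := q ^+ n.+1 * v in Ow.
have qn0 : q ^+ n != 0 by rewrite expf_neq0.
have vE : v = w / q ^+ n.+1 by rewrite /w mulrC mulKf // expf_neq0.
have e : q ^+ n * v = (d w - q ^+ n * z) * (n.+1%:R^-1 * (d q)^-1).
  have -> : d w = n.+1%:R * q ^+ n * d q * v + q ^+ n.+1 * d v.
    by rewrite /w (derM hd) (derX hd).
  by rewrite -dv exprS; move: n.+1%:R (char0 n) => N N0; field; rewrite dq0.
rewrite e; apply: locM; last exact: locM (loc_natV _) _.
by apply: locB; [exact: loc_der | apply: locM => //; exact: locX].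
Qed.

(** Since [d q] is a unit at a normal [Q], poles of order at least two are integrated away one order
    at a time. The remaining part, with at most a simple pole, is a regular multiple of
    [d q / q]. *)
Lemma hermite m f : O (q ^+ m.+1 * f) ->
  exists h r, [/\ O (q ^+ m * h), O r & f = d h + r * (d q / q)].
Proof.
elim: m f => [|m IH] f.
  rewrite expr1 => Of; exists 0, (q * f / d q); rewrite mulr0 (der0 hd).
  split; [exact: loc0 | exact: locM | by field; rewrite q0 dq0].
set w := q ^+ m.+2 * f => Ow.
(* Chosen so that the derivative of [-u / q^(m+1)] equals [f = w / q^(m+2)] up to a pole of order
   [m+1]. *)
pose u := w / (m.+1%:R * d q).
have Ou : O u by apply: locM => //; rewrite invfM; exact: locM (loc_natV _) _.
have Df : f = d (- u / q ^+ m.+1) + d u / q ^+ m.+1.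
  rewrite (der_div hd) ?expf_neq0 // (derX hd) (derN hd) /u.
  have ->: f = w / q ^+ m.+2 by rewrite /w mulrC mulKf // expf_neq0.
  by rewrite !exprS; move: m.+1%:R (char0 m) => N N0; field; rewrite dq0 q0 N0 expf_neq0.
have [|h [r [Oh Or fE]]] := IH (d u / q ^+ m.+1).
  by rewrite mulrC divfK ?expf_neq0 //; exact: loc_der.
exists (- u / q ^+ m.+1 + h), r; split=> //.
  rewrite mulrDr; apply: locD; last by rewrite exprS -mulrA; exact: locM.
  by rewrite mulrC divfK ?expf_neq0 //; exact: locN.
by rewrite Df fE (derD hd) addrA.
Qed.

Lemma fracs_pole y : fracs ev y -> exists n, O (q ^+ n * y).
Proof.
move=> [p [r [r0 ->]]]; have [n [s [ns ->]]] := irredp_mult irrQ r0.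
exists n; rewrite rmorphM rmorphXn.
have -> : q ^+ n * (ev p / (q ^+ n * ev s)) = ev p / ev s.
  by field; rewrite ndvd0 // expf_neq0.
by exists p, s.
Qed.

Lemma loc_pole_le m n y : (m <= n)%N -> O (q ^+ m * y) -> O (q ^+ n * y).
Proof.
by move=> /subnK <- Oy; rewrite exprD -mulrA; apply: locM => //; exact: locX.
Qed.

Lemma fracs_poleD y z : (exists n, O (q ^+ n * y)) -> (exists n, O (q ^+ n * z)) ->
  exists n, O (q ^+ n * (y + z)).
Proof.
move=> [m Oy] [n Oz]; exists (m + n)%N; rewrite mulrDr; apply: locD.
  by apply: loc_pole_le Oy; rewrite leq_addr.
by apply: loc_pole_le Oz; rewrite leq_addl.
Qed.

(* [res y r]: the class of [r] modulo [Q] is the residue of [y] at [Q],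
   normalised so that the logarithmic derivative of [Q] has residue 1. *)
Definition res (y r : E) : Prop :=
  O r /\ exists v o, [/\ exists n, O (q ^+ n * v), O o & y = d v + r * (d q / q) + o].

Definition locmax (y : E) : Prop := exists2 z, O z & y = q * z.

Lemma locmaxD y z : locmax y -> locmax z -> locmax (y + z).
Proof. by move=> [a Oa ->] [b Ob ->]; exists (a + b); rewrite ?mulrDr //; exact: locD. Qed.

Lemma locmaxMl y z : O y -> locmax z -> locmax (y * z).
Proof. by move=> Oy [a Oa ->]; exists (y * a); [exact: locM | ring]. Qed.

Lemma locmaxB y z : locmax y -> locmax z -> locmax (y - z).
Proof.
move=> my mz; apply: locmaxD => //; rewrite -mulN1r; apply: locmaxMl => //.
by apply: locN; exact: (loc_nat 1).
Qed.

Lemma resD y z r s : res y r -> res z s -> res (y + z) (r + s).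
Proof.
move=> [Or [v [o [pv Oo ->]]]] [Os [w [p [pw Op ->]]]].
split; first exact: locD.
exists (v + w), (o + p); split; [exact: fracs_poleD | exact: locD |].
by rewrite (derD hd); ring.
Qed.

Lemma resZ c y r : d c = 0 -> O c -> res y r -> res (c * y) (c * r).
Proof.
move=> dc Oc [Or [v [o [[n pv] Oo ->]]]]; split; first exact: locM.
exists (c * v), (c * o); split; [|exact: locM|].
  by exists n; rewrite mulrCA; exact: locM.
by rewrite (derM hd) dc; ring.
Qed.

Lemma res_der v : (exists n, O (q ^+ n * v)) -> res (d v) 0.
Proof.
move=> pv; split; first exact: loc0.
by exists v, 0; split=> //; [exact: loc0 | rewrite mul0r !addr0].
Qed.

Lemma res_loc o : O o -> res o 0.
Proof.
move=> Oo; split; first exact: loc0.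
exists 0, o; split=> //; last by rewrite (der0 hd) mul0r !add0r.
by exists 0; rewrite mulr0; exact: loc0.
Qed.

(** In [0 = d v + r (d q / q) + o] the product [q d v] is regular, hence so are [v] and [d v]. Then
    [r (d q / q)] is regular, which forces [q] to divide [r]. *)
Lemma res_eq0 r : res 0 r -> locmax r.
Proof.
move=> [Or [v [o [[n Ov] Oo /esym/eqP h]]]].
have Ov' : O v.
  apply: (@loc_max_der_pole n _ (- (r * d q) - q * o) Ov).
    by apply: locB; [apply/locN/locM => //; exact: loc_der | exact: locM].
  move: h; rewrite -addrA addr_eq0 => /eqP ->; by field.
exists (- (d v + o) / d q).
  by apply: locM => //; apply/locN/locD => //; exact: loc_der.
have -> : d v + o = - (r * (d q / q)).
  by apply/eqP; rewrite -addr_eq0 addrAC.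
by field; rewrite q0 dq0.
Qed.

Lemma res_uniq y r s : res y r -> res y s -> locmax (r - s).
Proof.
move=> ry rs; apply: res_eq0.
have c1 : d (-1) = 0 by rewrite (derN hd) (der1 hd) oppr0.
have O1 : O (-1) by apply: locN; exact: (loc_nat 1).
by have := resD ry (resZ c1 O1 rs); rewrite !mulN1r subrr.
Qed.

Lemma res_exists m y : O (q ^+ m * y) -> exists r, res y r.
Proof.
case: m => [|m] Oy; first by exists 0; apply: res_loc; rewrite expr0 mul1r in Oy.
have [h [r [Oh Or ->]]] := hermite Oy.
exists r; split=> //; exists h, 0; split; [by exists m|exact: loc0|by rewrite addr0].
Qed.

(** If [p = Q^n s] with [s] prime to [Q], then [δp/p = n δQ/Q + δs/s] has the multiplicity [n] as
    residue; a quotient yields a difference of multiplicities. *)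
Lemma res_dlog u : fracs ev u -> u != 0 ->
  exists e, d e = 0 /\ res (d u / u) e.
Proof.
have resp p : p != 0 -> exists2 n : nat, True & res (d (ev p) / ev p) n%:R.
  move=> p0; have [n [s [ns ->]]] := irredp_mult irrQ p0.
  have qn0 : q ^+ n != 0 by rewrite expf_neq0.
  exists n => //; rewrite rmorphM rmorphXn (dlogM hd) //; last exact: ndvd0.
  rewrite (dlogX hd) //.
  split; first exact: loc_nat.
  exists 0, (d (ev s) / ev s); split.
  - by exists 0; rewrite mulr0; exact: loc0.
  - by apply: locM (loc_evV ns); apply: loc_der; exact: loc_ev.
  - by rewrite (der0 hd) add0r.
move=> [p [r [r0 ->]]] u0.
have p0 : p != 0 by apply: contraNneq u0 => ->; rewrite rmorph0 mul0r.
have [m _ rm] := resp _ p0; have [n _ rn] := resp _ r0.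
exists (m%:R + -1 * n%:R); split.
  by rewrite mulN1r (derB hd) !(der_nat hd) subrr.
rewrite (dlogM hd) ?invr_eq0 ?ev_eq0 // (dlogV hd) ?ev_eq0 // -[- (_ / _)]mulN1r.
apply: resD => //; apply: resZ => //; first by rewrite (derN hd) (der1 hd) oppr0.
by apply: locN; exact: (loc_nat 1).
Qed.

Section Stable.
Variable x : E.
Hypothesis Ox : O x.
Hypothesis dx : d x = 1.

Lemma locmax_altsum m r : (forall j, (j <= m)%N -> locmax (r j)) -> locmax (altsum x m r).
Proof.
elim: m r => [|m IH] r mr; first exact: mr.
apply: locmaxB; first by apply: locmaxMl => //; apply: IH => j jm; exact/mr/leqW.
by apply: IH => j jm; exact: mr.
Qed.

(** Integration by parts: [x^j δh = δ(x^j h) - j x^(j-1) h], where the derivative has residue zero.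
    At [j = 0] the last term vanishes through its factor. *)
Lemma res_mulX h r s j : O r -> (exists n, O (q ^+ n * h)) -> (forall j, res (x ^+ j * h) (s j)) ->
  res (x ^+ j * (d h + r * (d q / q))) (x ^+ j * r - j%:R * s j.-1).
Proof.
move=> Or [n Oh] hs.
have res1 : res (d (x ^+ j * h)) 0.
  by apply: res_der; exists n; rewrite mulrCA; apply: locM => //; exact: locX.
have res2 : res (x ^+ j * r * (d q / q)) (x ^+ j * r).
  split; first by apply: locM => //; exact: locX.
  exists 0, 0; split; rewrite ?(der0 hd) ?add0r ?addr0 //; last exact: loc0.
  by exists 0; rewrite mulr0; exact: loc0.
have dk : d (- j%:R) = 0 by rewrite (derN hd) (der_nat hd) oppr0.
have := resD (resD res1 res2) (resZ dk (locN (loc_nat j)) (hs j.-1)).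
rewrite add0r !mulNr; congr (res _ _).
rewrite (derM hd); case: j {res1 res2 dk} => [|j].
  by rewrite !expr0 (der1 hd); ring.
by rewrite (derX hd) dx /=; ring.
Qed.

(** Induction on the pole order through [f = δh + a δq/q]. In the residues of [x^j f] the parts
    [x^j a] cancel by [altsum_geom], and [altsum_diff] turns the others into a multiple of the sum
    for [h], whose pole is smaller. *)
Lemma res_altsum m f r : O (q ^+ m * f) ->
  (forall j, (j <= m)%N -> res (x ^+ j * f) (r j)) -> locmax (altsum x m r).
Proof.
elim: m f r => [|m IH] f r Of fr.
  rewrite /= -[r 0%N]subr0; apply: (@res_uniq f).
    by have := fr 0%N (leqnn _); rewrite mul1r.
  by apply: res_loc; rewrite mul1r in Of.
have [h [a [Oh Oa fE]]] := hermite Of.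
have ex_s j : exists b, res (x ^+ j * h) b.
  apply: (@res_exists m).
  by rewrite mulrCA; apply: locM => //; exact: locX.
have [s hs] := choice ex_s.
have ph : exists n, O (q ^+ n * h) by exists m.
(* The residue of [x^j f] computed from [h] and [a]; it agrees with [r j] only modulo [q]. *)
pose t j := x ^+ j * a + -1 * (j%:R * s j.-1).
have -> : altsum x m.+1 r = altsum x m.+1 t + altsum x m.+1 (fun j => r j - t j).
  by rewrite -altsumD; apply: eq_altsum => j _; ring.
apply: locmaxD; last first.
  apply: locmax_altsum => j jm; apply: (@res_uniq (x ^+ j * f)); first exact: fr.
  by rewrite fE /t mulN1r; exact: res_mulX.
rewrite altsumD altsum_geom altsumMl altsum_diff add0r mulN1r opprK.
by apply: locmaxMl; [exact: loc_nat | apply: IH Oh _ => j _; exact: hs].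
Qed.

(** The alternating sum is divisible by [q] in the local ring and is also the image of an element of
    [k], so it is zero. Its entries being constants, differentiation isolates [e 0]. *)
Lemma res_const_eq0 m f e x0 : x = ev x0%:P -> O (q ^+ m * f) ->
  (forall j, d (e j) = 0) -> (forall j, exists c, e j = ev c%:P) ->
  (forall j, (j <= m)%N -> res (x ^+ j * f) (e j)) -> e 0%N = 0.
Proof.
move=> xE Of de ce fe; apply: (altsum_const_eq0 hd char0 dx de (m := m)).
have [z Oz zE] := res_altsum Of fe.
have [c cE] : exists c, altsum x m e = ev c%:P.
  elim: m e {de fe Of z Oz zE} ce => [|m IH] e ce; first exact: ce.
  have [a aE] := IH e ce; have [b bE] := IH (fun j => e j.+1) (fun j => ce j.+1).
  by exists (x0 * a - b); rewrite /= aE bE xE polyCB polyCM rmorphB rmorphM.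
have := loc_ev_dvd Oz (etrans (esym cE) zE).
rewrite cE; have [->|c0 Qc] := eqVneq c 0; first by rewrite polyC0 rmorph0.
have := dvdp_leq _ Qc; rewrite polyC_eq0 c0 size_polyC c0 => /(_ isT).
by rewrite leqNgt irrQ.1.
Qed.

End Stable.

(** Derivatives have residue zero, and a logarithmic derivative has an integer residue, here
    multiplied by a constant. *)
Lemma liouville_res (K : E -> Prop) y :
  (forall c, d c = 0 -> O c) -> (forall z, K z -> fracs ev z) ->
  liouville d K y -> exists e, d e = 0 /\ res y e.
Proof.
move=> Oc KK; elim=> {y} [v /KK Kv|c u dc /KK Ku u0|y z _ [a [da ya]] _ [b [db zb]]].
- by exists 0; split; [exact: (der0 hd) | apply: res_der; exact: fracs_pole].
- have [e [de ue]] := res_dlog Ku u0; exists (c * e).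
  by rewrite (derM hd) dc de mul0r mulr0 addr0; split=> //; apply: resZ => //; exact: Oc.
- by exists (a + b); rewrite (derD hd) da db addr0; split=> //; exact: resD.
Qed.

End Local.

(** * Subfields given by predicates *)

Record subfield (E : fieldType) (k : E -> Prop) : Prop := Subfield {
  subfield1 : k 1;
  subfieldD : forall x y, k x -> k y -> k (x + y);
  subfieldN : forall x, k x -> k (- x);
  subfieldM : forall x y, k x -> k y -> k (x * y);
  subfieldV : forall x, k x -> k x^-1 }.

Section SubfieldType.
Variables (E : fieldType) (k : E -> Prop) (hk : subfield k).

Definition subfield_pred of subfield k : {pred E} := [pred x | `[< k x >]].

Lemma subfield_divring : GRing.divring_closed (subfield_pred hk).
Proof.
split=> [|x y|x y]; rewrite !inE.
- exact/asboolP/(subfield1 hk).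
- by move=> /asboolP kx /asboolP ky; apply/asboolP/(subfieldD hk)/(subfieldN hk).
- by move=> /asboolP kx /asboolP ky; apply/asboolP/(subfieldM hk)/(subfieldV hk).
Qed.

HB.instance Definition _ := GRing.isDivringClosed.Build E (subfield_pred hk) subfield_divring.

Record subfield_type := SubfieldElt { sfval : E; _ : sfval \in subfield_pred hk }.

HB.instance Definition _ := [isSub for sfval].
HB.instance Definition _ := [Choice of subfield_type by <:].
HB.instance Definition _ := [SubChoice_isSubIntegralDomain of subfield_type by <:].
HB.instance Definition _ := [SubIntegralDomain_isSubField of subfield_type by <:].

(** Replaces the predicate by a field type, over which polynomials can be formed. *)
Lemma subfield_image : exists (L : fieldType) (j : {rmorphism L -> E}),
  forall x, k x <-> exists a, x = j a.
Proof.
exists subfield_type, (val : {rmorphism subfield_type -> E}) => x.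
split=> [kx|[[y hy] ->]]; last exact/asboolP.
have hx : x \in subfield_pred hk by rewrite inE; apply/asboolP.
by exists (SubfieldElt hx).
Qed.

End SubfieldType.

Section SubfieldTheory.
Variables (E : fieldType) (k : E -> Prop) (hk : subfield k).

Lemma subfield0 : k 0.
Proof. by rewrite -(subrr 1); apply: (subfieldD hk); [|apply: (subfieldN hk)]; exact: (subfield1 hk). Qed.

Lemma subfieldB x y : k x -> k y -> k (x - y).
Proof. by move=> kx ky; apply: (subfieldD hk) => //; exact: (subfieldN hk). Qed.

Lemma subfield_div x y : k x -> k y -> k (x / y).
Proof. by move=> kx ky; apply: (subfieldM hk) => //; exact: (subfieldV hk). Qed.

End SubfieldTheory.

Lemma gen_field_subfield (E : fieldType) (A : E -> Prop) : subfield (gen_field A).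
Proof. by split; [exact: gen_one | exact: gen_add | exact: gen_opp | exact: gen_mul | exact: gen_inv]. Qed.

Lemma gen_field_min (E : fieldType) (A k : E -> Prop) y : subfield k ->
  (forall x, A x -> k x) -> gen_field A y -> k y.
Proof. by move=> [k1 kD kN kM kV] Ak; elim; auto. Qed.

Lemma image_subfield (L E : fieldType) (j : {rmorphism L -> E}) :
  subfield (fun x => exists a, x = j a).
Proof.
split; first by exists 1; rewrite rmorph1.
- by move=> _ _ [a ->] [b ->]; exists (a + b); rewrite rmorphD.
- by move=> _ [a ->]; exists (- a); rewrite rmorphN.
- by move=> _ _ [a ->] [b ->]; exists (a * b); rewrite rmorphM.
- by move=> _ [a ->]; exists a^-1; rewrite fmorphV.
Qed.

Lemma fracs_subfield (k E : fieldType) (ev : {rmorphism {poly k} -> E}) :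
  injective ev -> subfield (fracs ev).
Proof.
move=> ev_inj; have ev0 p : p != 0 -> ev p != 0 by rewrite (ev_eq0 ev_inj).
split.
- by exists 1, 1; rewrite oner_neq0 rmorph1 divr1.
- move=> _ _ [p [q [q0 ->]]] [r [s [s0 ->]]]; exists (p * s + r * q), (q * s).
  by rewrite mulf_neq0 // rmorphD !rmorphM addf_div ?ev0.
- by move=> _ [p [q [q0 ->]]]; exists (- p), q; rewrite rmorphN mulNr.
- move=> _ _ [p [q [q0 ->]]] [r [s [s0 ->]]]; exists (p * r), (q * s).
  by rewrite mulf_neq0 // !rmorphM mulf_div.
- move=> _ [p [q [q0 ->]]]; have [->|p0] := eqVneq p 0.
    by exists 0, 1; rewrite oner_neq0 rmorph0 !mul0r invr0.
  by exists q, p; rewrite invf_div.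
Qed.

(** * Liouville forms over a subfield *)

Section Liouville.
Variables (E : fieldType) (d : E -> E) (k : E -> Prop).
Hypothesis hd : is_derivation d.
Hypothesis hk : subfield k.

Lemma liouvilleZ c y : d c = 0 -> k c -> liouville d k y -> liouville d k (c * y).
Proof.
move=> dc kc; elim=> {y} [v kv|e u de ku u0|y z _ IHy _ IHz].
- have -> : c * d v = d (c * v) by rewrite (derM hd) dc mul0r add0r.
  by apply: liouville_der; exact: (subfieldM hk).
- by rewrite mulrA; apply: liouville_dlog => //; rewrite (derM hd) dc de mul0r mulr0 addr0.
- by rewrite mulrDr; exact: liouville_add.
Qed.

Lemma liouvilleN y : liouville d k y -> liouville d k (- y).
Proof.
move=> ly; rewrite -mulN1r; apply: liouvilleZ => //; first by rewrite (derN hd) (der1 hd) oppr0.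
by apply: (subfieldN hk); exact: (subfield1 hk).
Qed.

Lemma liouvilleB y z : liouville d k y -> liouville d k z -> liouville d k (y - z).
Proof. by move=> ly lz; apply: liouville_add => //; exact: liouvilleN. Qed.

Lemma liouville_sub (K : E -> Prop) y : (forall x, k x -> K x) -> liouville d k y -> liouville d K y.
Proof.
move=> kK; elim=> {y} [v /kK|c u dc /kK Ku u0|y z _ ly _ lz].
- exact: liouville_der.
- exact: liouville_dlog.
- exact: liouville_add.
Qed.

End Liouville.

(** * Evaluation of polynomials and its derivative *)

Section EvalAt.
Variables (k E : fieldType) (j : {rmorphism k -> E}) (t : E).

Definition ev_at (p : {poly k}) : E := (map_poly j p).[t].

HB.instance Definition _ := GRing.RMorphism.copy ev_at (horner_eval t \o map_poly j).

Lemma ev_atC c : ev_at c%:P = j c. Proof. by rewrite /ev_at map_polyC hornerC. Qed.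
Lemma ev_atX : ev_at 'X = t. Proof. by rewrite /ev_at map_polyX hornerX. Qed.

Variables (d : E -> E) (dk : k -> k).
Hypothesis hd : is_derivation d.
Hypothesis djk : forall a, d (j a) = j (dk a).

Lemma der_restrict : is_derivation dk.
Proof.
by split=> a b; apply: (fmorph_inj j); rewrite ?rmorphD ?rmorphM -!djk ?rmorphD ?rmorphM ?(derD hd) ?(derM hd).
Qed.

Lemma coef_map_der p i : (map_poly dk p)`_i = dk p`_i.
Proof. by rewrite coef_map_id0 // (der0 der_restrict). Qed.

Lemma der_ev_at p : d (ev_at p) = ev_at (map_poly dk p) + ev_at p^`() * d t.
Proof.
elim/poly_ind: p => [|p c IH].
  by rewrite deriv0 map_poly0 !rmorph0 (der0 hd) mul0r addr0.
have -> : map_poly dk (p * 'X + c%:P) = map_poly dk p * 'X + (dk c)%:P.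
  apply/polyP => i; rewrite coef_map_der !coefD !coefMX !coefC coef_map_der.
  by case: i => [|i]; rewrite /= ?add0r ?addr0.
rewrite !rmorphD !rmorphM /= !ev_atX !ev_atC (derD hd) (derM hd) djk IH.
rewrite derivD derivM derivX derivC addr0 mulr1 rmorphD rmorphM /= ev_atX.
by ring.
Qed.

Lemma der_ev_at_lift w p : d t = ev_at w ->
  d (ev_at p) = ev_at (map_poly dk p + p^`() * w).
Proof. by move=> dt; rewrite der_ev_at dt -rmorphM -rmorphD. Qed.

End EvalAt.

(** * Descent through a transcendental logarithm or exponential *)

Section TranscendentalStep.
Variables (k E : fieldType) (j : {rmorphism k -> E}) (ev : {rmorphism {poly k} -> E}).
Variables (d : E -> E) (dk : k -> k) (D : {poly k} -> {poly k}).
Hypothesis hd : is_derivation d.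
Hypothesis djk : forall a, d (j a) = j (dk a).
Hypothesis evC : forall c, ev c%:P = j c.
Hypothesis ev_inj : injective ev.
Hypothesis d_ev : forall p, d (ev p) = ev (D p).
Hypothesis const_k : forall c, d c = 0 -> exists a, c = j a.
Local Notation im := (fun x => exists a, x = j a).

(* [b] is the argument of the exponential, and 0 in the logarithmic case. *)
Variable b : k.
Hypothesis sizeD : forall p, (size (D p) <= size p)%N.
Hypothesis lead_D : forall p, p != 0 ->
  (D p)`_(size p).-1 = dk (lead_coef p) + (size p).-1%:R * dk b * lead_coef p.
Hypothesis D_const : forall p c, D p = c%:P -> liouville d im (j c).

(** A complement of the polynomials in [k(t)], stable under [d] because [D] does not raise degrees.
    The descent compares the two components. *)
Definition proper_frac (y : E) :=
  exists p q : {poly k}, [/\ q != 0, (size p < size q)%N & y = ev p / ev q].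

Let im_sub : subfield im := image_subfield j.
Let ev0 p : p != 0 -> ev p != 0. Proof. by rewrite (ev_eq0 ev_inj). Qed.

Lemma proper_fracD y z : proper_frac y -> proper_frac z -> proper_frac (y + z).
Proof.
move=> [p [q [q0 pq ->]]] [r [s [s0 rs ->]]]; exists (p * s + r * q), (q * s).
split; [by rewrite mulf_neq0 | | by rewrite rmorphD !rmorphM addf_div ?ev0].
have lt_mul (u v w : {poly k}) : v != 0 -> w != 0 -> (size u < size w)%N ->
    (size (u * v)%R < size (w * v)%R)%N.
  move=> v0 w0 uw; apply: leq_ltn_trans (size_polyMleq _ _) _; rewrite (size_mul w0 v0).
  by rewrite -size_poly_gt0 in v0; rewrite -(ltn_predK v0) !addnS ltn_add2r.
apply: leq_ltn_trans (size_polyD _ _) _.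
by rewrite gtn_max lt_mul //= (mulrC q s) lt_mul.
Qed.

Lemma proper_fracZ a y : proper_frac y -> proper_frac (j a * y).
Proof.
move=> [p [q [q0 pq ->]]]; exists (a%:P * p), q; split=> //; last by rewrite rmorphM evC mulrA.
by rewrite mul_polyC; apply: leq_ltn_trans (size_scale_leq _ _) pq.
Qed.

Lemma proper_frac_der y : proper_frac y -> proper_frac (d y).
Proof.
move=> [p [q [q0 pq ->]]]; exists (D p * q - p * D q), (q * q).
rewrite mulf_neq0 // (der_div hd) ?ev0 // !d_ev rmorphB !rmorphM; split=> //.
have lt_mul (u v : {poly k}) : (size u < size q)%N -> (size v <= size q)%N ->
    (size (u * v)%R < size (q * q)%R)%N.
  move=> uq vq; apply: leq_ltn_trans (size_polyMleq _ _) _; rewrite (size_mul q0 q0).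
  rewrite -size_poly_gt0 in q0; move: (size u) (size v) (size q) uq vq q0 => x1 x2 x3; lia.
apply: leq_ltn_trans (size_polyD _ _) _; rewrite size_polyN gtn_max !lt_mul //.
exact: leq_ltn_trans (sizeD _) _.
Qed.

Lemma proper_frac_ev p : proper_frac (ev p) -> p = 0.
Proof.
move=> [r [q [q0 rq /eqP]]]; rewrite eq_sym (can2_eq (divfK (ev0 q0)) (mulfK (ev0 q0))).
rewrite -rmorphM (inj_eq ev_inj) => /eqP rE; apply: contraTeq rq => p0.
rewrite rE size_mul // -leqNgt; move: p0 q0; rewrite -!size_poly_gt0.
by move: (size p) (size q) => a c; lia.
Qed.

(** [c] is the ratio of the coefficients of [D p] and [p] at the degree of [p], so [D p - c p] drops
    in degree. By [lead_D], [c] is a logarithmic derivative plus a derivative of elements of [k]. *)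
Lemma dlog_split p : p != 0 -> exists l m,
  [/\ liouville d im l, im l, proper_frac m & d (ev p) / ev p = l + m].
Proof.
move=> p0; pose n := (size p).-1; pose e := n%:R * dk b.
have lp0 : lead_coef p != 0 by rewrite lead_coef_eq0.
pose c := dk (lead_coef p) / lead_coef p + e.
exists (j c), (ev (D p - c *: p) / ev p); split; last 1 first.
- rewrite d_ev rmorphB -mul_polyC rmorphM evC mulrBl mulfK ?ev0 //; ring.
- rewrite rmorphD fmorph_div -djk; apply: liouville_add.
    by rewrite -[X in liouville _ _ X]mul1r; apply: liouville_dlog;
      [exact: (der1 hd) | exists (lead_coef p) | rewrite fmorph_eq0].
  have -> : j e = d (j (n%:R * b)).
    by rewrite djk (derM (der_restrict hd djk)) (der_nat (der_restrict hd djk)) mul0r add0r.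
  by apply: liouville_der; exists (n%:R * b).
- by exists c.
- exists (D p - c *: p), p; split=> //.
  have sp : (0 < size p)%N by rewrite size_poly_gt0.
  rewrite -(ltn_predK sp) ltnS; apply/leq_sizeP => i; rewrite leq_eqVlt => /orP [/eqP <-|lt_i].
    by rewrite coefB coefZ lead_D // -lead_coefE /c -/n -/e; field.
  have le_i : (size p <= i)%N by rewrite -(ltn_predK sp).
  by rewrite coefB coefZ !nth_default ?mulr0 ?subrr // (leq_trans (sizeD _)).
Qed.

(** Euclidean division splits the argument of a derivative, and [dlog_split] handles the logarithmic
    terms. Constants lie in [k], so multiplying by them respects the parts. *)
Lemma liouville_split y : liouville d (fracs ev) y -> exists w l m,
  [/\ liouville d im l, im l, proper_frac m & y = ev (D w) + l + m].
Proof.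
elim=> {y} [v [p [q [q0 ->]]]|c u dc [p [q [q0 ->]]] u0|y z _ [w [l [m [Ll il pm ->]]]]
   _ [w' [l' [m' [Ll' il' pm' ->]]]]].
- exists (p %/ q), 0, (d (ev (p %% q) / ev q)); split.
  + by rewrite -(der0 hd); apply: liouville_der; exact: (subfield0 im_sub).
  + exact: (subfield0 im_sub).
  + by apply: proper_frac_der; exists (p %% q), q; rewrite ltn_modp.
  + rewrite addr0 -d_ev -(derD hd) {1}(divp_eq p q) rmorphD rmorphM.
    by congr d; field; exact: ev0.
- have [a cE] := const_k dc.
  have p0 : p != 0 by apply: contraNneq u0 => ->; rewrite rmorph0 mul0r.
  have [l [m [Ll il pm lE]]] := dlog_split p0.
  have [l' [m' [Ll' il' pm' lE']]] := dlog_split q0.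
  exists 0, (c * (l - l')), (c * (m + j (-1) * m')); split.
  + by apply: (liouvilleZ hd im_sub dc); [exists a | exact: (liouvilleB hd im_sub)].
  + by apply: (subfieldM im_sub); [exists a | exact: (subfieldB im_sub)].
  + by rewrite cE; apply: proper_fracZ; apply: proper_fracD => //; exact: proper_fracZ.
  + have -> : D 0 = 0 by apply: ev_inj; rewrite -d_ev rmorph0 (der0 hd).
    rewrite (dlogM hd) ?invr_eq0 ?ev0 // (dlogV hd) ?ev0 // lE lE' rmorph0 add0r.
    by rewrite rmorphN rmorph1; ring.
- exists (w + w'), (l + l'), (m + m'); split.
  + exact: liouville_add.
  + exact: (subfieldD im_sub).
  + exact: proper_fracD.
  + by rewrite -!d_ev rmorphD (derD hd); ring.
Qed.

(** Comparing components, the proper part [m] is zero and [D w] is the element [a - c] of [k], to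
    which [D_const] applies. *)
Lemma transcendental_step a : liouville d (fracs ev) (j a) -> liouville d im (j a).
Proof.
move=> /liouville_split [w [l [m [Ll [c cE] pm aE]]]].
have Dw : D w = (a - c)%:P.
  apply/eqP; rewrite eq_sym -subr_eq0; apply/eqP; apply: proper_frac_ev.
  have -> // : ev ((a - c)%:P - D w) = m.
  by rewrite rmorphB evC rmorphB aE cE; ring.
have -> : a = (a - c) + c by rewrite subrK.
by rewrite rmorphD; apply: liouville_add; [exact: (D_const Dw) | rewrite -cE].
Qed.

End TranscendentalStep.

Section LogExpStep.
Variables (k E : fieldType) (j : {rmorphism k -> E}) (t : E).
Variables (d : E -> E) (dk : k -> k).
Hypothesis hd : is_derivation d.
Hypothesis djk : forall a, d (j a) = j (dk a).
Hypothesis char0 : forall n, n.+1%:R != 0 :> E.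
Hypothesis const_k : forall c, d c = 0 -> exists a, c = j a.
Hypothesis t_transc : injective (ev_at j t).
Local Notation im := (fun x => exists a, x = j a).
Local Notation ev := (ev_at j t).

Let hdk : is_derivation dk := der_restrict hd djk.

(** The point is that a polynomial in [t] with derivative in [k] has the form [p_0 + p_1 t] with
    [p_1] constant, and its derivative is [δp_0 + p_1 δa/a]. *)
Lemma log_step a c : a != 0 -> d t = d (j a) / j a ->
  liouville d (fracs ev) (j c) -> liouville d im (j c).
Proof.
move=> a0 dt; pose b := dk a / a; have dtb : d t = ev b%:P.
  by rewrite ev_atC fmorph_div -djk.
pose D p := map_poly dk p + p^`() * b%:P.
have coefD p i : (D p)`_i = dk p`_i + p`_i.+1 *+ i.+1 * b.
  by rewrite coefD coefMC coef_deriv (coef_map_der hd djk).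
apply: (transcendental_step hd djk (ev_atC j t) t_transc (D := D) (b := 0) _ const_k) => [p|p|p p0|p e Dp].
- by rewrite (der_ev_at_lift hd djk _ dtb).
- apply/leq_sizeP => i sp; rewrite coefD !nth_default // ?(leqW sp) //.
  by rewrite (der0 hdk) mul0rn mul0r addr0.
- rewrite coefD (der0 hdk) mulr0 mul0r addr0 prednK ?size_poly_gt0 //.
  by rewrite [p`_(size p)]nth_default // mul0rn mul0r addr0.
- have [sp|] := leqP (size p) 2.
  have -> : e = dk p`_0 + p`_1 * b.
    by have := coefD p 0%N; rewrite Dp coefC /= mulr1n.
  have dp1 : dk p`_1 = 0.
    have := coefD p 1%N; rewrite Dp coefC /= [p`_2]nth_default // mul0rn mul0r addr0.
    by move=> <-.
  rewrite rmorphD rmorphM fmorph_div -!djk; apply: liouville_add.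
    by apply: liouville_der; exists p`_0.
  by apply: liouville_dlog; [rewrite djk dp1 rmorph0 | exists a | rewrite fmorph_eq0].
case sp : (size p) => [|[|[|n]]] // _.
have dpn : dk p`_n.+2 = 0.
  have := coefD p n.+2; rewrite Dp coefC /= [p`_n.+3]nth_default ?sp // mul0rn mul0r addr0.
  by move=> <-.
have dpn1 : dk p`_n.+1 + p`_n.+2 *+ n.+2 * b = 0.
  by rewrite -coefD Dp coefC.
(* In degree at least two, the top two coefficients give a constant of [E]. As constants lie in [k],
   [t] would satisfy an equation of degree one over [k]. *)
have [|s sE] := const_k (c := j p`_n.+1 + j (p`_n.+2 *+ n.+2) * t).
  rewrite (derD hd) (derM hd) !djk dt; move: dpn1 => /(congr1 j).
  rewrite rmorph0 rmorphD rmorphM fmorph_div -djk => e1.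
  by rewrite -mulr_natr (derM hdk) dpn (der_nat hdk) mul0r mulr0 addr0 rmorph0 mul0r add0r mulr_natr [d (j a)]djk.
have : ev ((p`_n.+1)%:P + (p`_n.+2 *+ n.+2)%:P * 'X - s%:P) = ev 0.
  by rewrite rmorphB rmorphD rmorphM /= !ev_atC ev_atX sE subrr rmorph0.
move=> /t_transc /(congr1 (fun q : {poly k} => q`_1)).
rewrite !coefE /= mulr1 add0r subr0 => /eqP; rewrite -mulr_natr mulf_eq0.
have -> : (p`_n.+2 == 0) = false by apply/negbTE; rewrite -[n.+2]/(n.+3.-1) -sp -lead_coefE lead_coef_eq0 -size_poly_gt0 sp.
by rewrite -(fmorph_eq0 j) rmorph_nat (negPf (char0 _)).
Qed.

(** [D] acts on each coefficient separately, sending [p_i] to [δp_i + i δa p_i]. An element of [k]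
    in its image is therefore the derivative of [p_0]. *)
Lemma exp_step a c : d t = t * d (j a) ->
  liouville d (fracs ev) (j c) -> liouville d im (j c).
Proof.
move=> dt; pose b := dk a; have dtb : d t = ev (b%:P * 'X).
  by rewrite rmorphM /= ev_atC ev_atX dt djk mulrC.
pose D p := map_poly dk p + p^`() * (b%:P * 'X).
have coefD p i : (D p)`_i = dk p`_i + i%:R * b * p`_i.
  rewrite coefD mulrA coefMX coefMC (coef_map_der hd djk); congr (_ + _).
  by case: i => [|i] /=; [rewrite !mul0r | rewrite coef_deriv -mulr_natr; ring].
apply: (transcendental_step hd djk (ev_atC j t) t_transc (D := D) (b := a) _ const_k) => [p|p|p p0|p e Dp].
- by rewrite (der_ev_at_lift hd djk _ dtb).
- apply/leq_sizeP => i sp; rewrite coefD !nth_default //.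
  by rewrite (der0 hdk) mulr0 addr0.
- by rewrite coefD.
- have -> : e = dk p`_0 by have := coefD p 0%N; rewrite Dp coefC /= => ->; ring.
  by rewrite -djk; apply: liouville_der; exists p`_0.
Qed.

End LogExpStep.

(** * Derivatives of determinants and traces *)

Section DetDerivation.
Variables (R : comNzRingType) (d : R -> R).
Hypothesis hd : is_derivation d.

Lemma der_prod (I : finType) (f : I -> R) :
  d (\prod_i f i) = \sum_i d (f i) * \prod_(l | l != i) f l.
Proof.
have der_prod_seq (r : seq I) : uniq r ->
    d (\prod_(i <- r) f i) = \sum_(i <- r) d (f i) * \prod_(l <- r | l != i) f l.
  elim: r => [|a r IH] /=; first by rewrite !big_nil (der1 hd).
  case/andP=> ar ur; rewrite !big_cons (derM hd) IH // eqxx; congr (_ * _ + _).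
    rewrite [RHS]big_seq_cond [LHS]big_seq; apply: eq_bigl => l.
    by case: eqP => [->|_]; rewrite ?(negPf ar) // andbT.
  rewrite big_distrr /= big_seq [RHS]big_seq; apply: eq_bigr => i ir.
  rewrite big_cons; case: eqP => [ai|_]; first by rewrite ai ir in ar.
  by rewrite mulrCA.
by rewrite der_prod_seq ?index_enum_uniq.
Qed.

(** Jacobi's formula: the product rule differentiates one row at a time, and each resulting
    determinant is expanded along that row. *)
Lemma der_det n (A : 'M[R]_n) : d (\det A) = \tr (map_mx d A *m \adj A).
Proof.
pose B i : 'M[R]_n := \matrix_(l, m) if l == i then d (A l m) else A l m.
transitivity (\sum_i \det (B i)).
  rewrite (der_sum hd) exchange_big /=; apply: eq_bigr => s _.
  have sgn0 (b : bool) : d ((-1) ^+ b) = 0.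
    by case: b; rewrite ?expr1 ?expr0 ?(derN hd) (der1 hd) ?oppr0.
  rewrite (derM hd) sgn0 mul0r add0r der_prod big_distrr /=; apply: eq_bigr => i _; congr (_ * _).
  rewrite [RHS](bigD1 i) //= mxE eqxx; congr (_ * _); apply: eq_bigr => l li.
  by rewrite mxE (negPf li).
apply: eq_bigr => i _; rewrite (expand_det_row _ i) mxE; apply: eq_bigr => m _.
rewrite !mxE eqxx; congr (_ * (_ * \det _)).
by apply/matrixP => a c; rewrite !mxE eq_sym (negPf (neq_lift _ _)).
Qed.

Lemma der_mulmx m n p (A : 'M[R]_(m, n)) (B : 'M[R]_(n, p)) :
  map_mx d (A *m B) = map_mx d A *m B + A *m map_mx d B.
Proof.
apply/matrixP => i l; rewrite !mxE (der_sum hd) -big_split /=; apply: eq_bigr => h _.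
by rewrite (derM hd) !mxE.
Qed.

Lemma der_mxtrace n (A : 'M[R]_n) : \tr (map_mx d A) = d (\tr A).
Proof. by rewrite (der_sum hd); apply: eq_bigr => i _; rewrite mxE. Qed.

End DetDerivation.

(** * Descent through an algebraic element by traces *)

Section AlgebraicStep.
Variables (k E : fieldType) (j : {rmorphism k -> E}) (t : E).
Variables (d : E -> E) (dk : k -> k).
Hypothesis hd : is_derivation d.
Hypothesis djk : forall a, d (j a) = j (dk a).
Hypothesis char0 : forall n, n.+1%:R != 0 :> E.
Hypothesis const_k : forall c, d c = 0 -> exists a, c = j a.
Local Notation im := (fun x => exists a, x = j a).
Local Notation ev := (ev_at j t).
Local Notation im_ev := (fun x => exists p, x = ev p).

Let hdk : is_derivation dk := der_restrict hd djk.

Variables (n : nat) (mu : {poly k}).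
Hypothesis size_mu : size mu = n.+2.
Hypothesis ev_mu : ev mu = 0.
Hypothesis mu_min : forall p : {poly k}, p != 0 -> ev p = 0 -> (size mu <= size p)%N.

Let mu0 : mu != 0. Proof. by rewrite -size_poly_gt0 size_mu. Qed.

Lemma ev_eq0_lt (p : {poly k}) : (size p < size mu)%N -> ev p = 0 -> p = 0.
Proof.
move=> sp ep; apply: contraTeq sp => p0; rewrite -leqNgt; exact: mu_min.
Qed.

Lemma ev_modp p : ev p = ev (p %% mu).
Proof. by rewrite {1}(divp_eq p mu) rmorphD rmorphM /= ev_mu mulr0 add0r. Qed.

Lemma im_ev_subfield : subfield im_ev.
Proof.
split; first by exists 1; rewrite rmorph1.
- by move=> _ _ [p ->] [q ->]; exists (p + q); rewrite rmorphD.
- by move=> _ [p ->]; exists (- p); rewrite rmorphN.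
- by move=> _ _ [p ->] [q ->]; exists (p * q); rewrite rmorphM.
move=> _ [p ->]; have [->|ep0] := eqVneq (ev p) 0.
  by exists 0; rewrite rmorph0 invr0.
pose g := gcdp p mu.
have g0 : ev g != 0.
  apply: contraNneq ep0 => eg; have /dvdpP [q ->] := dvdp_gcdl p mu.
  by rewrite rmorphM /= -/g eg mulr0.
(* In [mu = h g] the value [g(t)] is nonzero, so [h(t) = 0], and minimality of [mu] leaves degree
   zero for [g]. Bezout then inverts [p(t)]. *)
have sg : size g = 1%N.
  have /dvdpP [h mE] : g %| mu := dvdp_gcdr p mu.
  have h0 : h != 0 by apply: contraNneq mu0 => h0; rewrite mE h0 mul0r.
  have gn0 : g != 0 by apply: contraNneq g0 => ->; rewrite rmorph0.
  have /eqP := ev_mu; rewrite mE rmorphM mulf_eq0 (negPf g0) orbF => /eqP /(mu_min h0).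
  have := size_mul h0 gn0; rewrite -mE; rewrite -!size_poly_gt0 in h0 gn0.
  by move: (size g) (size h) (size mu) h0 gn0 => a b c; lia.
have [[u v] /= uv] := Bezoutp p mu.
have /size_poly1P [c c0 cE] : size (u * p + v * mu) == 1%N by rewrite (eqp_size uv) sg.
exists ((c^-1)%:P * u); rewrite rmorphM /= ev_atC fmorphV.
have jcE : j c = ev u * ev p.
  by rewrite -(ev_atC j t) -cE rmorphD !rmorphM /= ev_mu mulr0 addr0.
by rewrite jcE; field; rewrite ep0 -(fmorph_eq0 j) jcE in c0 *; move: c0; rewrite mulf_eq0 negb_or => /andP [].
Qed.

(** Separability in characteristic zero: [mu'] is nonzero and of smaller degree than the minimal
    polynomial. *)
Lemma ev_deriv_neq0 : ev mu^`() != 0.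
Proof.
have smu : (size mu^`() < size mu)%N by rewrite lt_size_deriv.
apply/eqP => /(ev_eq0_lt smu) /(congr1 (fun p : {poly k} => p`_n)) /eqP.
rewrite coef0 coef_deriv -mulr_natr mulf_eq0 -[X in mu`_X]/(n.+2.-1) -size_mu -lead_coefE.
by rewrite lead_coef_eq0 (negPf mu0) -(fmorph_eq0 j) rmorph_nat (negPf (char0 n)).
Qed.

(** Differentiating [mu(t) = 0] and dividing by [mu'(t)] expresses [δt] in [k(t)]. *)
Lemma im_ev_der y : im_ev y -> im_ev (d y).
Proof.
have [w tE] : im_ev (d t).
  have := der_ev_at t hd djk mu; rewrite ev_mu (der0 hd) => /esym/eqP.
  rewrite addrC addr_eq0 => /eqP h.
  have -> : d t = - ev (map_poly dk mu) / ev mu^`() by rewrite -h; field; exact: ev_deriv_neq0.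
  apply: (subfield_div im_ev_subfield); last by exists mu^`().
  by exists (- map_poly dk mu); rewrite rmorphN.
by move=> [p ->]; exists (map_poly dk p + p^`() * w); exact: der_ev_at_lift.
Qed.

Let W : 'cV[E]_n.+1 := \col_i t ^+ i.

Lemma pow_basis_free m (M N : 'M[k]_(m, n.+1)) :
  map_mx j M *m W = map_mx j N *m W -> M = N.
Proof.
move=> MN; apply/matrixP => i l; apply/eqP; rewrite -subr_eq0.
pose p := rVpoly (row i (M - N)).
have sp : (size p <= n.+1)%N by exact: size_poly.
have /ev_eq0_lt : (size p < size mu)%N by rewrite size_mu ltnS.
have ep : ev p = 0.
  rewrite /ev_at (@horner_coef_wide _ n.+1) ?size_map_poly //.
  move/(congr1 (fun A : 'cV[E]_m => A i 0)): MN => /eqP.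
  rewrite !mxE -subr_eq0 -sumrB => /eqP e0; rewrite -[RHS]e0; apply: eq_bigr => h _.
  by rewrite coef_map /= coef_rVpoly_ord !mxE rmorphB mulrBl.
move=> /(_ ep) /(congr1 (fun q : {poly k} => q`_l)).
by rewrite coef_rVpoly_ord !mxE coef0 => ->.
Qed.

Lemma pow_basis_span m (y : 'cV[E]_m) : (forall i, im_ev (y i 0)) ->
  exists M : 'M[k]_(m, n.+1), map_mx j M *m W = y.
Proof.
move=> /choice [p pE]; exists (\matrix_(i, l) (p i %% mu)`_l).
apply/colP => i; rewrite !mxE pE ev_modp /ev_at (@horner_coef_wide _ n.+1).
  by apply: eq_bigr => l _; rewrite !mxE coef_map.
by rewrite size_map_poly -ltnS -size_mu ltn_modp.
Qed.

(** [mat v] is multiplication by [v] in the basis of powers of [t], with the column [W] of basis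
    elements as eigenvector. Outside [k(t)] its value is left arbitrary. *)
Lemma mulmat_exists : exists mat : E -> 'M[k]_n.+1,
  forall v, im_ev v -> map_mx j (mat v) *m W = v *: W.
Proof.
suff /choice [mat matE] : forall v, exists M, im_ev v -> map_mx j M *m W = v *: W.
  by exists mat.
move=> v; have [iv|niv] := pselect (im_ev v); last by exists 0.
have [|M ME] := @pow_basis_span n.+1 (v *: W); last by exists M.
move=> i; rewrite !mxE; apply: (subfieldM im_ev_subfield) => //.
by exists ('X^i); rewrite rmorphXn /= ev_atX.
Qed.

(** The trace from [k(t)] to [k] commutes with the derivation, sends [δu/u] to the logarithmic
    derivative of the norm of [u], and multiplies [c] by the degree [n+1]. *)
Lemma algebraic_step c : liouville d im_ev (j c) -> liouville d im (j c).
Proof.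
have [mat matE] := mulmat_exists.
have im_im_ev a : im_ev (j a) by exists a%:P; rewrite ev_atC.
have matD u v : im_ev u -> im_ev v -> mat (u + v) = mat u + mat v.
  move=> iu iv; apply: pow_basis_free; rewrite map_mxD mulmxDl !matE ?scalerDl //.
  exact: (subfieldD im_ev_subfield).
have matM u v : im_ev u -> im_ev v -> mat (u * v) = mat u *m mat v.
  move=> iu iv; apply: pow_basis_free; rewrite map_mxM -mulmxA !matE //; last first.
    exact: (subfieldM im_ev_subfield).
  by rewrite -scalemxAr matE // scalerA mulrC.
have matC a : mat (j a) = a%:M.
  by apply: pow_basis_free; rewrite matE // map_scalar_mx mul_scalar_mx.
have [A AE] : exists A : 'M[k]_n.+1, map_mx j A *m W = map_mx d W.
  apply: pow_basis_span => i; rewrite !mxE; apply: im_ev_der.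
  by exists ('X^i); rewrite rmorphXn /= ev_atX.
(* Differentiating [mat v *m W = v *: W] produces a commutator with the matrix [A] of the derivation
   on the basis; commutators have trace zero. *)
have mat_der v : im_ev v -> mat (d v) = map_mx dk (mat v) + mat v *m A - A *m mat v.
  move=> iv; apply: pow_basis_free; rewrite matE; last exact: im_ev_der.
  rewrite map_mxB map_mxD !map_mxM mulmxBl mulmxDl -!mulmxA matE // AE.
  have := congr1 (map_mx d) (matE v iv); rewrite (der_mulmx hd).
  have -> : map_mx d (v *: W) = d v *: W + v *: map_mx d W.
    by apply/matrixP => i l; rewrite !mxE (derM hd).
  have -> : map_mx d (map_mx j (mat v)) = map_mx j (map_mx dk (mat v)).
    by apply/matrixP => i l; rewrite !mxE djk.
  by move=> ->; rewrite -scalemxAr AE addrK.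
have tr_der v : im_ev v -> \tr (mat (d v)) = dk (\tr (mat v)).
  by move=> iv; rewrite mat_der // mxtraceD linearD /= linearN /= (mxtrace_mulC (mat v)) addrK (der_mxtrace hdk).
(* After multiplication by the inverse of [mat u] the two terms in [A] still cancel under the trace.
   What is left is Jacobi's formula for the norm. *)
have tr_dlog u : im_ev u -> u != 0 ->
    \det (mat u) != 0 /\ \tr (mat (d u / u)) = dk (\det (mat u)) / \det (mat u).
  move=> iu u0; have iuV := subfieldV im_ev_subfield iu.
  have matV : mat u *m mat u^-1 = 1%:M by rewrite -matM // mulfV // -(rmorph1 j) matC.
  have unit_u : mat u \in unitmx by case/mulmx1_unit: matV.
  have det0 : \det (mat u) != 0 by rewrite -unitfE -unitmxE.
  split=> //; rewrite matM //; last exact: im_ev_der.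
  have -> : mat u^-1 = invmx (mat u) by rewrite -[LHS](mulKmx unit_u) matV mulmx1.
  rewrite mat_der // mulmxBl mulmxDl !mxtraceD linearN /= -addrA.
  rewrite -(mulmxA A) mulmxV // mulmx1 (mxtrace_mulC (_ *m A)) mulmxA mulVmx // mul1mx.
  by rewrite subrr addr0 /invmx unit_u -scalemxAr mxtraceZ (der_det hdk) mulrC.
have trace_liouville y : liouville d im_ev y -> im_ev y /\ liouville d im (j (\tr (mat y))).
  elim=> {y} [v iv|e u de iu u0|y z _ [iy ly] _ [iz lz]].
  - split; first exact: im_ev_der.
    by rewrite tr_der // -djk; apply: liouville_der; exists (\tr (mat v)).
  - have [a eE] := const_k de.
    have idu : im_ev (d u / u) by apply: (subfield_div im_ev_subfield); first exact: im_ev_der.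
    have [det0 trE] := tr_dlog u iu u0.
    rewrite eE; split; first exact: (subfieldM im_ev_subfield).
    rewrite matM // matC mul_scalar_mx mxtraceZ trE rmorphM fmorph_div -djk -eE.
    by apply: liouville_dlog => //; [exists (\det (mat u)) | rewrite fmorph_eq0].
  - split; first exact: (subfieldD im_ev_subfield).
    by rewrite matD // mxtraceD rmorphD; exact: liouville_add.
move=> /trace_liouville [_]; rewrite matC mxtrace_scalar => lc.
have -> : j c = (n.+1%:R)^-1 * j (c *+ n.+1).
  by rewrite rmorphMn /= -[j c *+ _]mulr_natr mulrC mulfK.
apply: (liouvilleZ hd (image_subfield j)) => //.
  by rewrite (derV hd) // (der_nat hd) oppr0 mul0r.
by exists (n.+1%:R)^-1; rewrite fmorphV rmorph_nat.
Qed.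

End AlgebraicStep.

Lemma fracs_ev (k E : fieldType) (ev : {rmorphism {poly k} -> E}) p : fracs ev (ev p).
Proof. by exists p, 1; rewrite oner_neq0 rmorph1 divr1. Qed.

Lemma elementary_over_sub (E : fieldType) (d : E -> E) (k K : E -> Prop) t :
  (forall x, k x -> K x) -> elementary_over d k t -> elementary_over d K t.
Proof.
move=> kK [[p [p0 [kp pt]]]|[[t0 [a [ka dt]]]|[a [ka [a0 dt]]]]].
- by left; exists p; split=> //; split=> // i; exact: kK.
- by right; left; split=> //; exists a; split=> //; exact: kK.
- by right; right; exists a; split=> //; exact: kK.
Qed.

(** * Descent along an elementary tower *)

Section Tower.
Variables (E : fieldType) (d : E -> E).
Hypothesis hd : is_derivation d.
Hypothesis char0 : forall n, n.+1%:R != 0 :> E.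

Lemma gen_field_der (A : E -> Prop) : (forall a, A a -> gen_field A (d a)) ->
  forall y, gen_field A y -> gen_field A (d y).
Proof.
move=> Ad y; have gs := gen_field_subfield A.
elim=> {y} [a /Ad //|y z _ dy _ dz|y _ dy||y z gy dy gz dz|y gy dy].
- by rewrite (derD hd); exact: gen_add.
- by rewrite (derN hd); exact: gen_opp.
- by rewrite (der1 hd); exact: (subfield0 gs).
- by rewrite (derM hd); apply: gen_add; exact: gen_mul.
- have [->|y0] := eqVneq y 0; first by rewrite invr0 (der0 hd); exact: (subfield0 gs).
  rewrite (derV hd) //; apply: gen_mul; first exact: gen_opp.
  by apply: gen_inv; exact: gen_mul.
Qed.

Lemma adjoin_step (k : E -> Prop) t : subfield k ->
  (forall x, k x -> k (d x)) -> (forall c, d c = 0 -> k c) -> elementary_over d k t ->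
  let kt := gen_field (fun y => k y \/ y = t) in
  (forall x, kt x -> kt (d x)) /\ (forall f, k f -> liouville d kt f -> liouville d k f).
Proof.
move=> ks kd kc el_t kt; have [L [j kE]] := subfield_image ks.
have gs : subfield kt := gen_field_subfield _.
have ktj a : kt (j a) by apply: gen_base; left; apply/kE; exists a.
have ktt : kt t by apply: gen_base; right.
have ktev p : kt (ev_at j t p).
  elim/poly_ind: p => [|p c IH]; first by rewrite rmorph0; exact: (subfield0 gs).
  rewrite rmorphD rmorphM /= ev_atX ev_atC.
  by apply: (subfieldD gs) => //; exact: (subfieldM gs).
have ex_dk a : exists b, d (j a) = j b by apply/kE/kd/kE; exists a.
have [dk djk] := choice ex_dk.
have const_k c : d c = 0 -> exists a, c = j a by move=> /kc /kE.
have kt_der : kt (d t) -> forall x, kt x -> kt (d x).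
  by move=> dt; apply: gen_field_der => x [kx|->//]; apply: gen_base; left; exact: kd.
have descend (S : E -> Prop) : subfield S -> (forall p, S (ev_at j t p)) ->
    (forall c, liouville d S (j c) -> liouville d (fun x => exists a, x = j a) (j c)) ->
    forall f, k f -> liouville d kt f -> liouville d k f.
  move=> Ss Sev step _ /kE [c ->] lc.
  apply: (liouville_sub (fun x => (kE x).2)); apply: step; apply: liouville_sub lc => x.
  apply: gen_field_min => // y [/kE [a ->]|->].
    by rewrite -(ev_atC j t).
  by rewrite -(ev_atX j t).
(* The split is on whether [t] satisfies a polynomial over [k], not on the clause of
   [elementary_over], since a logarithm or exponential may be algebraic. *)
have [alg|transc] := pselect (exists p, p != 0 /\ ev_at j t p = 0).
  have : exists n, `[< exists p : {poly L}, [/\ p != 0, ev_at j t p = 0 & size p = n] >].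
    by have [p [p0 ep]] := alg; exists (size p); apply/asboolP; exists p.
  case/ex_minnP => n /asboolP [mu [mu0 emu smu]] n_min.
  have mu_min (p : {poly L}) : p != 0 -> ev_at j t p = 0 -> (size mu <= size p)%N.
    by move=> p0 ep; rewrite smu; apply: n_min; apply/asboolP; exists p.
  have [m smu2] : exists m, size mu = m.+2.
    case sz : (size mu) => [|[|m]]; last by exists m.
      by move: mu0; rewrite -size_poly_gt0 sz.
    have /size_poly1P [c c0 cE] : size mu == 1%N by rewrite sz.
    by move: c0; rewrite -(fmorph_eq0 j) -(ev_atC j t) -cE emu eqxx.
  have im_sub := im_ev_subfield smu2 emu mu_min.
  split.
    apply: kt_der; have [|w ->//] := im_ev_der hd djk char0 smu2 emu mu_min (y := t).
    by exists 'X; rewrite ev_atX.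
  apply: (descend _ im_sub) => [p|c]; first by exists p.
  exact: (algebraic_step hd djk char0 const_k smu2 emu mu_min).
have ev_inj : injective (ev_at j t).
  move=> p q pq; apply/eqP; rewrite -subr_eq0; apply: contrapT => /negP pq0.
  by apply: transc; exists (p - q); rewrite rmorphB /= pq subrr.
have dsc := descend _ (fracs_subfield ev_inj) (@fracs_ev _ _ (ev_at j t)).
case: el_t => [[p [p0 [kp pt]]]|[[t0 [a [/kE [b bE] dt]]]|[a [/kE [b bE] [a0 dt]]]]].
- have ex_q i : exists b, p`_i = j b by apply/kE.
  have [g gE] := choice ex_q; exfalso; apply: transc.
  exists (\poly_(i < size p) g i).
  have qE : map_poly j (\poly_(i < size p) g i) = p.
    apply/polyP => i; rewrite coef_map coef_poly; case: ltnP => [_|sp].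
      by rewrite /= -gE.
    by rewrite /= rmorph0 nth_default.
  split; last by rewrite /ev_at qE; exact/eqP.
  by rewrite -(map_poly_eq0 j) qE.
- have dtE : d t = t * d (j b) by rewrite -bE -dt mulrC divfK.
  split.
    by apply: kt_der; rewrite dtE djk; exact: (subfieldM gs).
  by apply: dsc => c; exact: (exp_step hd djk const_k ev_inj dtE).
- have dtE : d t = d (j b) / j b by rewrite -bE.
  have b0 : b != 0 by rewrite -(fmorph_eq0 j) -bE.
  split.
    by apply: kt_der; rewrite dtE djk; exact: (subfield_div gs).
  by apply: dsc => c; exact: (log_step hd djk char0 const_k ev_inj b0 dtE).
Qed.

(** The base [k] holds all constants of [E], so no stage adds any. By induction the form descends to
    [k(t)] for the lowest generator [t], and [adjoin_step] brings it to [k]. *)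
Lemma liouville_tower ts (k : E -> Prop) : subfield k ->
  (forall x, k x -> k (d x)) -> (forall c, d c = 0 -> k c) ->
  (forall i, (i < size ts)%N ->
    elementary_over d (gen_field (fun y => k y \/ y \in take i ts)) (nth 0 ts i)) ->
  forall f, k f -> liouville d (gen_field (fun y => k y \/ y \in ts)) f -> liouville d k f.
Proof.
elim: ts k => [|t ts IH] k ks kd kc el f kf lf.
  by apply: liouville_sub lf => x; apply: gen_field_min => // y [].
pose kt := gen_field (fun y => k y \/ y = t).
have gs : subfield kt := gen_field_subfield _.
have el_t : elementary_over d k t.
  have := el 0%N isT; apply: elementary_over_sub => x.
  by apply: gen_field_min => // y [].
have [ktd step] := adjoin_step ks kd kc el_t.
have k_kt x : k x -> kt x by move=> kx; apply: gen_base; left.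
apply: step => //; apply: (IH kt) => //.
- by move=> c /kc /k_kt.
- move=> i lti; have := el i.+1 lti; apply: elementary_over_sub => x.
  apply: gen_field_min; first exact: gen_field_subfield.
  move=> y [ky|]; first by apply: gen_base; left; exact: k_kt.
  rewrite /= inE => /orP [/eqP ->|yi]; last by apply: gen_base; right.
  by apply: gen_base; left; apply: gen_base; right.
- exact: k_kt.
- apply: liouville_sub lf => x; apply: gen_field_min; first exact: gen_field_subfield.
  move=> y [ky|]; first by apply: gen_base; left; exact: k_kt.
  rewrite inE => /orP [/eqP ->|yi]; last by apply: gen_base; right.
  by apply: gen_base; left; apply: gen_base; right.
Qed.

End Tower.

(** * Linear disjointness of constants and constant field extension *)

Lemma rmorphism_lift (F L E : fieldType) (h : {rmorphism F -> E}) (j : {rmorphism L -> E}) :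
  (forall a, exists b, h a = j b) -> exists phi : {rmorphism F -> L}, forall a, h a = j (phi a).
Proof.
move=> /choice [phi phiE].
have phiB : zmod_morphism phi.
  by move=> a b; apply: (fmorph_inj j); rewrite rmorphB -!phiE rmorphB.
have phiM : monoid_morphism phi.
  split; first by apply: (fmorph_inj j); rewrite -phiE !rmorph1.
  by move=> a b; apply: (fmorph_inj j); rewrite rmorphM -!phiE rmorphM.
pose phiA := GRing.isZmodMorphism.Build _ _ phi phiB.
pose phiR := GRing.isMonoidMorphism.Build _ _ phi phiM.
pose phi' : {rmorphism F -> L} := HB.pack phi phiA phiR.
by exists phi'.
Qed.

Section ConstantsLinearlyDisjoint.
Variables (K E : fieldType) (D : K -> K) (d : E -> E) (iota : {rmorphism K -> E}).
Hypothesis hD : is_derivation D.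
Hypothesis hd : is_derivation d.
Hypothesis d_iota : forall a, d (iota a) = iota (D a).

(** As for Wronskians: normalise one coefficient of the relation to 1 and differentiate. Either
    every coefficient is constant, or a shorter nontrivial relation appears. *)
Lemma const_dependent n (c : 'I_n -> E) (q : 'I_n -> K) :
  (forall i, d (c i) = 0) -> \sum_i c i * iota (q i) = 0 -> (exists i, q i != 0) ->
  exists a : 'I_n -> K, [/\ forall i, D (a i) = 0, exists i, a i != 0
                          & \sum_i c i * iota (a i) = 0].
Proof.
elim: n c q => [|n IH] c q dc sum0 [l ql0]; first by case: l ql0.
pose r i := q i / q l.
have sumr : \sum_i c i * iota (r i) = 0.
  transitivity ((\sum_i c i * iota (q i)) / iota (q l)); last by rewrite sum0 mul0r.
  by rewrite mulr_suml; apply: eq_bigr => i _; rewrite fmorph_div mulrA.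
have sumDr : \sum_i c i * iota (D (r i)) = 0.
  have := congr1 d sumr; rewrite (der0 hd) (der_sum hd) => e0; rewrite -[RHS]e0.
  apply: eq_bigr => i _.
  by rewrite (derM hd) dc mul0r add0r d_iota.
have rl : r l = 1 by rewrite /r divff.
have [allD|] := pselect (forall i, D (r i) = 0).
  by exists r; split=> //; exists l; rewrite rl oner_neq0.
move/existsNP => [i /eqP Dri].
have [i' iE] : exists i', i = lift l i'.
  have : l != i by apply: contraNneq Dri => <-; rewrite rl (der1 hD).
  by move/unlift_some => [i' -> _]; exists i'.
rewrite (bigD1_ord l) //= rl (der1 hD) rmorph0 mulr0 add0r in sumDr.
have [||a [Da [i1 ai1] suma]] := IH (fun i => c (lift l i)) (fun i => D (r (lift l i))) _ sumDr.
- by move=> i1; exact: dc.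
- by exists i'; rewrite -iE.
exists (fun i => if unlift l i is Some i1 then a i1 else 0); split.
- by move=> i2; case: (unlift l i2) => [i3|]; [exact: Da | exact: (der0 hD)].
- by exists (lift l i1); rewrite liftK.
- rewrite (bigD1_ord l) //= unlift_none rmorph0 mulr0 add0r -[RHS]suma.
  by apply: eq_bigr => i2 _; rewrite liftK.
Qed.

End ConstantsLinearlyDisjoint.

Section ConstantExtension.
Variables (F K E : fieldType) (ev0 : {rmorphism {poly F} -> K}) (D : K -> K) (d : E -> E).
Variable iota : {rmorphism K -> E}.
Hypothesis ev0_inj : injective ev0.
Hypothesis hD : is_derivation D.
Hypothesis hd : is_derivation d.
Hypothesis d_iota : forall a, d (iota a) = iota (D a).
Hypothesis constK : forall u, D u = 0 -> exists c, u = ev0 c%:P.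

Variable h : {rmorphism F -> E}.
Hypothesis hE : forall a, h a = iota (ev0 a%:P).
Let t := iota (ev0 'X).

Lemma iota_ev p : iota (ev0 p) = (map_poly h p).[t].
Proof.
elim/poly_ind: p => [|p c IH]; first by rewrite !rmorph0 horner0.
rewrite rmorphD rmorphM /= rmorphD rmorphM /= IH.
by rewrite rmorphD rmorphM /= map_polyX map_polyC hornerD hornerMX hornerC /= hE.
Qed.

(** Constants of [K] lie in [F], so [const_dependent] expresses some [c l] through the others with
    coefficients in [F]. Substituting it changes the relation and its [m]-th coefficient in the same
    way, and leaves one term fewer. *)
Lemma const_poly_relation n (c : 'I_n -> E) (q : 'I_n -> {poly F}) m :
  (forall i, d (c i) = 0) -> \sum_i c i * iota (ev0 (q i)) = 0 ->
  \sum_i c i * h (q i)`_m = 0.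
Proof.
elim: n c q => [|n IH] c q dc sum0; first by rewrite big_ord0.
have [q0|] := pselect (forall i, q i = 0).
  by rewrite big1 // => i _; rewrite q0 coef0 rmorph0 mulr0.
move=> /existsNP [i0 /eqP qi0].
have [|a [Da [l al0] suma]] := const_dependent hD hd d_iota dc sum0.
  by exists i0; rewrite (ev_eq0 ev0_inj).
have /choice [b bE] : forall i, exists b, a i = ev0 b%:P.
  by move=> i; exact: constK.
have bl0 : b l != 0 by apply: contraNneq al0 => bl; rewrite bE bl polyC0 rmorph0.
have hbl0 : h (b l) != 0 by rewrite fmorph_eq0.
have iotab i : iota (a i) = h (b i) by rewrite bE hE.
pose g i := - (b i / b l).
have clE : c l = \sum_(i < n) c (lift l i) * h (g (lift l i)).
  move: suma; rewrite (bigD1_ord l) //= iotab => /eqP; rewrite addr_eq0 => /eqP e.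
  rewrite -[LHS](mulfK hbl0) e mulNr mulr_suml -sumrN; apply: eq_bigr => i _.
  by rewrite iotab /g rmorphN fmorph_div mulrN mulrA.
have sumE : \sum_i c (lift l i) * h (q (lift l i) + (g (lift l i))%:P * q l)`_m = 0.
  apply: (IH (fun i => c (lift l i)) (fun i => q (lift l i) + (g (lift l i))%:P * q l)) => [i|].
    exact: dc.
  rewrite -[RHS]sum0 [RHS](bigD1_ord l) //= clE mulr_suml -big_split /=.
  apply: eq_bigr => i _; rewrite hE rmorphD rmorphM /= rmorphD rmorphM /=.
  by rewrite mulrDr addrC mulrA.
rewrite -[RHS]sumE (bigD1_ord l) //= clE mulr_suml -big_split /=.
apply: eq_bigr => i _; rewrite coefD coefCM (rmorphD h) (rmorphM h).
by rewrite mulrDr addrC mulrA.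
Qed.

Variables (L : fieldType) (j : {rmorphism L -> E}).
Hypothesis jE : forall y, gen_field (fun z => (exists a, z = h a) \/ d z = 0) y <-> exists a, y = j a.

(** The polynomials over [L = F(C)] lying in the span of [F[X]] over the constants [C] of [E], where
    [const_poly_relation] applies. *)
Let decomposable (p : {poly L}) := exists s : seq (E * {poly F}),
  (forall x, x \in s -> d x.1 = 0) /\
  map_poly j p = \sum_(x <- s) x.1 *: map_poly h x.2.

Let decD p q : decomposable p -> decomposable q -> decomposable (p + q).
Proof.
move=> [s [ds ps]] [s' [ds' qs]]; exists (s ++ s'); rewrite big_cat rmorphD /= ps qs; split=> //.
by move=> x; rewrite mem_cat => /orP [/ds|/ds'].
Qed.

Let decM p q : decomposable p -> decomposable q -> decomposable (p * q).
Proof.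
move=> [s [ds ps]] [s' [ds' qs]].
exists [seq (x.1 * y.1, x.2 * y.2) | x <- s, y <- s']; split.
  by move=> _ /allpairsP [[x y] /= [xs ys ->]] /=; rewrite (derM hd) ds // ds' // mul0r mulr0 addr0.
rewrite rmorphM /= ps qs big_allpairs_dep mulr_suml; apply: eq_bigr => x _.
rewrite mulr_sumr; apply: eq_bigr => y _.
by rewrite /= rmorphM /= -!mul_polyC polyCM mulrACA.
Qed.

Let decC c : d (j c) = 0 -> decomposable c%:P.
Proof.
move=> dc; exists [:: (j c, 1)]; split=> [x|]; first by rewrite inE => /eqP ->.
by rewrite big_seq1 /= rmorph1 map_polyC -mul_polyC mulr1.
Qed.

Let decF c a : j c = h a -> decomposable c%:P.
Proof.
move=> ca; exists [:: (1, a%:P)]; split=> [x|].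
  by rewrite inE => /eqP ->; exact: (der1 hd).
by rewrite big_seq1 /= scale1r !map_polyC /= ca.
Qed.

Let decX : decomposable 'X.
Proof.
exists [:: (1, 'X)]; split=> [x|]; first by rewrite inE => /eqP ->; exact: (der1 hd).
by rewrite big_seq1 /= scale1r !map_polyX.
Qed.

Let dec1 : decomposable 1.
Proof. by apply: (decC (c := 1)); rewrite rmorph1 (der1 hd). Qed.

Let decN1 : decomposable (-1).
Proof. by rewrite -polyCN; apply: decC; rewrite rmorphN rmorph1 (derN hd) (der1 hd) oppr0. Qed.

(** Quotients of decomposable elements form a subfield containing the generators of [L], hence all
    of [L]. *)
Let denomC c : exists s, [/\ s != 0, decomposable s%:P & decomposable (s * c)%:P].
Proof.
pose Q (y : E) := exists c s, [/\ y = j c, s != 0, decomposable s%:P & decomposable (s * c)%:P].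
suff [c' [s [/(fmorph_inj j) <- s0 ds dsc]]] : Q (j c) by exists s.
have : gen_field (fun z => (exists a, z = h a) \/ d z = 0) (j c) by apply/jE; exists c.
apply: gen_field_min; first split.
- by exists 1, 1; rewrite rmorph1 oner_neq0 mulr1 polyC1.
- move=> _ _ [a [s [-> s0 ds dsa]]] [b [r [-> r0 dr drb]]]; exists (a + b), (s * r).
  rewrite rmorphD mulf_neq0 // polyCM; split=> //; first exact: decM.
  have -> : s * r * (a + b) = r * (s * a) + s * (r * b) by ring.
  by rewrite polyCD (polyCM r) (polyCM s (r * b)); apply: decD; exact: decM.
- move=> _ [a [s [-> s0 ds dsa]]]; exists (- a), s; rewrite rmorphN s0; split=> //.
  by rewrite mulrN -mulN1r polyCM; apply: decM => //; rewrite polyCN.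
- move=> _ _ [a [s [-> s0 ds dsa]]] [b [r [-> r0 dr drb]]]; exists (a * b), (s * r).
  rewrite rmorphM mulf_neq0 // polyCM; split=> //; first exact: decM.
  by rewrite mulrACA polyCM; exact: decM.
- move=> _ [a [s [-> s0 ds dsa]]]; have [->|a0] := eqVneq a 0.
    by exists 0, 1; rewrite rmorph0 invr0 oner_neq0 mulr0; split=> //; apply: decC; rewrite rmorph0 (der0 hd).
  by exists a^-1, (s * a); rewrite fmorphV mulf_neq0 // mulfK.
- move=> y yA; have [b bE] : exists b, y = j b by apply/jE; exact: gen_base.
  exists b, 1; rewrite oner_neq0 mul1r; split=> //.
  case: yA => [[a ya]|dy]; last by apply: decC; rewrite -bE.
  by apply: (@decF _ a); rewrite -bE.
Qed.

(** After clearing denominators, an equation for [t] over [F(C)] becomes a relation between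
    constants and elements of [F[t]], which holds coefficient by coefficient. *)
Lemma constant_extension_transc : injective (ev_at j t).
Proof.
have denom (p : {poly L}) : exists s, [/\ s != 0, decomposable s%:P & decomposable (s%:P * p)].
  elim/poly_ind: p => [|p c [s [s0 ds dsp]]].
    by exists 1; rewrite oner_neq0 mulr0; split=> //; rewrite -polyC0; apply: decC; rewrite rmorph0 (der0 hd).
  have [r [r0 dr drc]] := denomC c; exists (s * r); rewrite mulf_neq0 // polyCM; split=> //.
    exact: decM.
  have -> : s%:P * r%:P * (p * 'X + c%:P) = r%:P * (s%:P * p) * 'X + s%:P * (r * c)%:P.
    by rewrite polyCM; ring.
  by apply: decD; [apply: decM => //; exact: decM | exact: decM].
have ker0 (p : {poly L}) : ev_at j t p = 0 -> p = 0.
  move=> ep; have [s [s0 _ [r [dr prE]]]] := denom p.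
  suff /eqP : s%:P * p = 0 by rewrite mulf_eq0 polyC_eq0 (negPf s0) => /eqP.
  pose c (i : 'I_(size r)) := (nth (0, 0) r i).1; pose q (i : 'I_(size r)) := (nth (0, 0) r i).2.
  have dc i : d (c i) = 0 by apply: dr; exact: mem_nth.
  apply/eqP; rewrite -(map_poly_eq0 j) prE; apply/eqP/polyP => m.
  rewrite coef0 (big_nth (0, 0)) big_mkord coef_sum.
  rewrite -[RHS](const_poly_relation (c := c) (q := q) m dc); last first.
    transitivity (ev_at j t (s%:P * p)); last by rewrite rmorphM /= ep mulr0.
    rewrite /ev_at prE (big_nth (0, 0)) big_mkord horner_sum; apply: eq_bigr => i _.
    by rewrite hornerZ iota_ev.
  by apply: eq_bigr => i _; rewrite coefZ coef_map.
move=> p q pq; apply/eqP; rewrite -subr_eq0; apply/eqP/ker0.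
by rewrite rmorphB /= pq subrr.
Qed.

End ConstantExtension.

(** * Residues of stable elements at normal polynomials *)

(** By parts, [x^(k+1) δ^(n+2) g = δ(x^(k+1) δ^(n+1) g) - (k+1) x^k δ^(n+1) g], and the last term
    has an integral by induction. *)
Lemma der_iter_integrable (E : fieldType) (d : E -> E) (x g : E) k n :
  is_derivation d -> d x = 1 -> (k <= n)%N ->
  exists y, x ^+ k * iter n.+1 d g = d y.
Proof.
move=> hd dx; elim: k n => [|k IH] n kn; first by exists (iter n d g); rewrite expr0 mul1r.
case: n kn => // n kn; have [y yE] := IH n kn.
exists (x ^+ k.+1 * iter n.+1 d g - k.+1%:R * y).
rewrite (derB hd) !(derM hd) (der_nat hd) -yE (derX hd) dx /=; ring.
Qed.

Section Stable.
Variables (F K : fieldType) (ev0 : {rmorphism {poly F} -> K}).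
Variables (d : F -> F) (D : K -> K) (Dp : {poly F} -> {poly F}).
Hypothesis ev0_inj : injective ev0.
Hypothesis ev0_fracs : forall u, fracs ev0 u.
Hypothesis char0 : forall n, n.+1%:R != 0 :> K.
Hypothesis x_ex : exists x : F, d x = 1.
Hypothesis hD : is_derivation D.
Hypothesis D_C : forall c : F, D (ev0 c%:P) = ev0 (d c)%:P.
Hypothesis constK : forall u, D u = 0 -> exists c, u = ev0 c%:P.
Hypothesis D_ev0 : forall p, D (ev0 p) = ev0 (Dp p).

Lemma stable_normal_pole f P : stable_elem D f -> irreducible_poly P -> ~~ (P %| Dp P) ->
  exists h, locring ev0 P (f - D h).
Proof.
move=> [gs gsP] irrP nP.
have [M Of] := fracs_pole ev0_inj irrP (ev0_fracs f).
case: M Of => [|M] Of.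
  by exists 0; rewrite (der0 hD) subr0; move: Of; rewrite expr0 mul1r.
have [h [r [Oh [a [b [nb rE]]] fE]]] := hermite ev0_inj hD D_ev0 char0 irrP nP Of.
exists h.
have P0 : ev0 P != 0 by rewrite (ev_eq0 ev0_inj) irredp_neq0.
have b0 : ev0 b != 0 by rewrite (ev_eq0 ev0_inj); apply: contraNneq nb => ->; rewrite dvdp0.
(* A factor [P] in the numerator of [r] cancels the pole of [r δP/P]. *)
suff /dvdpP [a1 aE] : P %| a.
  have -> : f - D h = ev0 (a1 * Dp P) / ev0 b.
    by rewrite fE rE aE D_ev0 !rmorphM; field; rewrite b0 P0.
  by exists (a1 * Dp P), b.
(* The pole has order at most [M+1], so integrals of [x^i f] are needed for [i <= M+1]; this takes
   [f] as a derivative of order [M+2]. *)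
move: (gsP M.+2) => {gsP}; case: (gs M.+2) => E [dE [iota g]] [[hdE [d_iota [ts [el gen]]]] iotaf].
have char0E n : n.+1%:R != 0 :> E.
  by rewrite -(rmorph_nat iota) fmorph_eq0.
have [h0 h0E] : exists h0 : {rmorphism F -> E}, forall c, h0 c = iota (ev0 c%:P).
  by exists (iota \o (ev0 \o polyC)).
pose A1 z := (exists c, z = h0 c) \/ dE z = 0.
have gsA1 : subfield (gen_field A1) := gen_field_subfield _.
have [L [j jE]] := subfield_image gsA1.
pose t := iota (ev0 'X).
have t_inj : injective (ev_at j t).
  exact: (constant_extension_transc ev0_inj hD hdE d_iota constK h0E jE).
have [phi phiE] : exists phi : {rmorphism F -> L}, forall c, h0 c = j (phi c).
  by apply: rmorphism_lift => c; apply/jE/gen_base; left; exists c.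
have ev_phi p : ev_at j t (map_poly phi p) = iota (ev0 p).
  rewrite (iota_ev h0E) /ev_at -map_poly_comp; congr (_.[_]); apply: eq_map_poly => c.
  by rewrite /= phiE.
have ex_dL y : exists z, dE (j y) = j z.
  apply/jE; apply: gen_field_der => //; last by apply/jE; exists y.
  move=> z [[c ->]|->]; last exact: (subfield0 gsA1).
  by apply: gen_base; left; exists (d c); rewrite !h0E d_iota D_C.
have [dL djL] := choice ex_dL.
have [T T_ev] : exists T, forall p, dE (ev_at j t p) = ev_at j t (T p).
  exists (fun p => map_poly dL p + p^`() * map_poly phi (Dp 'X)) => p.
  by apply: (der_ev_at_lift hdE djL); rewrite ev_phi -D_ev0 d_iota.
have hT : is_derivation T := der_lift t_inj hdE T_ev.
have const_L c : dE c = 0 -> exists c', c = ev_at j t c'%:P.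
  move=> dc; have /jE [c' ->] : gen_field A1 c by apply: gen_base; right.
  by exists c'; rewrite ev_atC.
(* The field [K(C)]: the descent needs a base containing all constants of [E], and [K1_fracs]
   identifies its elements as fractions over [F(C)]. *)
pose K0 z := (exists u, z = iota u) \/ dE z = 0.
pose K1 := gen_field K0.
have gsK1 : subfield K1 := gen_field_subfield _.
have K1_iota u : K1 (iota u) by apply: gen_base; left; exists u.
have K1_fracs z : K1 z -> fracs (ev_at j t) z.
  apply: gen_field_min => [|y [[u ->]|dy]]; first exact: fracs_subfield.
    have [p [q [q0 ->]]] := ev0_fracs u; exists (map_poly phi p), (map_poly phi q).
    by rewrite map_poly_eq0 fmorph_div !ev_phi.
  by have [c ->] := const_L y dy; exact: fracs_ev.
have K1d z : K1 z -> K1 (dE z).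
  apply: gen_field_der => // y [[u ->]|->]; last exact: (subfield0 gsK1).
  by rewrite d_iota; exact: K1_iota.
have [Q [irrQ QP]] : exists Q, irreducible_poly Q /\ Q %| map_poly phi P.
  by apply: irredp_factor; rewrite size_map_poly; case: irrP.
have nQ1 : ~~ (Q %= 1) by rewrite -size_poly_eq1 neq_ltn irrQ.1 orbT.
have Q_coprime p : ~~ (P %| p) -> ~~ (Q %| map_poly phi p).
  move=> np; apply: contraNN nQ1 => Qp.
  have /coprimepP : coprimep (map_poly phi P) (map_poly phi p).
    by rewrite coprimep_map irredp_coprime.
  exact.
have [R PRE] := dvdpP _ _ QP.
have TP : T (map_poly phi P) = map_poly phi (Dp P).
  by apply: t_inj; rewrite -T_ev !ev_phi d_iota D_ev0.
have nQTP := Q_coprime _ nP; rewrite -TP PRE (derM hT) in nQTP.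
(* In [T(RQ) = T(R) Q + R T(Q)], a factor [Q] of [T Q] or of [R] would divide the image of [Dp P],
   which stays coprime to that of [P]. So [Q] is normal and divides [P] only once. *)
have nQ : ~~ (Q %| T Q) by apply: contraNN nQTP => QTQ; rewrite dvdp_add ?dvdp_mull.
have nR : ~~ (Q %| R) by apply: contraNN nQTP => QR; apply: dvdp_add; [exact: dvdp_mull | exact: dvdp_mulr].
have O_iota y : locring ev0 P y -> locring (ev_at j t) Q (iota y).
  move=> [p [q [nq ->]]]; exists (map_poly phi p), (map_poly phi q).
  by rewrite Q_coprime // fmorph_div !ev_phi.
have R0 : ev_at j t R != 0 by rewrite (ev_eq0 t_inj); apply: contraNneq nR => ->; rewrite dvdp0.
have Q0 : ev_at j t Q != 0 by rewrite (ev_eq0 t_inj) irredp_neq0.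
have iotaP : iota (ev0 P) = ev_at j t R * ev_at j t Q by rewrite -ev_phi PRE rmorphM.
have O_iota_pole n y : locring ev0 P (ev0 P ^+ n * y) -> locring (ev_at j t) Q (ev_at j t Q ^+ n * iota y).
  move=> /O_iota; rewrite rmorphM rmorphXn iotaP => Oy.
  have -> : ev_at j t Q ^+ n * iota y = (ev_at j t R)^-1 ^+ n * ((ev_at j t R * ev_at j t Q) ^+ n * iota y).
    by rewrite !exprMn mulrA mulrA -exprMn mulVf // expr1n mul1r.
  by apply: (locM irrQ) => //; apply: (locX irrQ); exact: loc_evV.
have [x0 dx0] := x_ex.
pose x := iota (ev0 x0%:P).
have xE : x = ev_at j t (phi x0)%:P by rewrite /x -ev_phi map_polyC.
have dx : dE x = 1 by rewrite /x d_iota D_C dx0 polyC1 !rmorph1.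
have O_const c : dE c = 0 -> locring (ev_at j t) Q c.
  by move=> /const_L [c' ->]; exact: loc_ev.
(* Beyond [M+1] the residue is set to 0, so that choice yields a total sequence of constants. *)
have xf_res i : exists e, dE e = 0 /\ ((i <= M.+1)%N -> res (ev_at j t) dE Q (x ^+ i * iota f) e).
  case: (leqP i M.+1) => [iM|_]; last by exists 0; rewrite (der0 hdE).
  have [y yE] := der_iter_integrable g hdE dx iM; rewrite -iotaf in yE.
  suff /(liouville_res t_inj hdE T_ev irrQ O_const K1_fracs) : liouville dE K1 (x ^+ i * iota f).
    by case=> e [de re]; exists e.
  apply: (liouville_tower hdE char0E gsK1 K1d (ts := ts)) => [c dc|i' lti||].
  - by apply: gen_base; right.
  - have := el i' lti; apply: elementary_over_sub => z.
    apply: gen_field_min => [|w [[u ->]|wi]]; first exact: gen_field_subfield.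
      by apply: gen_base; left.
    by apply: gen_base; right.
  - apply: (subfieldM gsK1); last exact: K1_iota.
    by rewrite /x -rmorphXn.
  - rewrite yE; apply: liouville_der; move: (gen y).
    apply: gen_field_min => [|w [[u ->]|wi]]; first exact: gen_field_subfield.
      by apply: gen_base; left.
    by apply: gen_base; right.
have [e eP] := choice xf_res.
have Ox : locring (ev_at j t) Q x by rewrite xE; exact: loc_ev.
have e0 : e 0%N = 0.
  apply: (res_const_eq0 t_inj hdE T_ev char0E irrQ nQ Ox dx xE (O_iota_pole _ _ Of)) => i.
  - by have [] := eP i.
  - by have [/const_L] := eP i.
  - by have [_] := eP i.
have res0 : res (ev_at j t) dE Q (iota f) 0.
  by have [_ /(_ isT)] := eP 0%N; rewrite e0 expr0 mul1r.
have Or : locring ev0 P r by exists a, b.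
(* Since [δP/P = δQ/Q + δR/R] with the last term regular at [Q], Hermite reduction at [P] also
   computes the residue at [Q]. *)
have res_r : res (ev_at j t) dE Q (iota f) (iota r).
  split; first exact: O_iota.
  exists (iota h), (iota r * (dE (ev_at j t R) / ev_at j t R)); split; [by exists M; exact: O_iota_pole | |].
    apply: (locM irrQ); [exact: O_iota | apply: (locM irrQ)]; last exact: loc_evV.
    by rewrite T_ev; exact: loc_ev.
  rewrite fE rmorphD rmorphM fmorph_div -!d_iota iotaP (dlogM hdE) //; ring.
have [z Oz zE] := res_uniq t_inj hdE T_ev char0E irrQ nQ res_r res0.
have Qa : Q %| map_poly phi a.
  apply: (loc_ev_dvd t_inj irrQ (y := z * ev_at j t (map_poly phi b))).
    by apply: (locM irrQ) => //; exact: loc_ev.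
  rewrite mulrA -zE subr0 rE fmorph_div -!ev_phi divfK //.
  by rewrite ev_phi fmorph_eq0.
by apply: contraTT Qa; exact: Q_coprime.
Qed.

(** * Special denominators and removal of normal poles *)

Lemma der_ev0_poly : is_derivation Dp.
Proof. exact: der_lift ev0_inj hD D_ev0. Qed.

(** Split off one irreducible factor at a time: in [δ(cP) = δc P + c δP] both terms are divisible by
    [cP]. *)
Lemma dvdp_der_of_factors b : b != 0 ->
  (forall P, irreducible_poly P -> P %| b -> P %| Dp P) -> b %| Dp b.
Proof.
have [n] := ubnP (size b); elim: n b => // n IH b; rewrite ltnS => szb b0 Pb.
have [sb|/irredp_factor [P [irrP /dvdpP [c bE]]]] := leqP (size b) 1.
  have /size_poly1P [c c0 ->] : size b == 1%N by rewrite eqn_leq sb size_poly_gt0.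
  by apply: dvdp_trans (dvd1p _); rewrite dvdp1 size_polyC c0.
have c0 : c != 0 by apply: contraNneq b0 => c0; rewrite bE c0 mul0r.
have cDc : c %| Dp c.
  apply: IH => // [|Q irrQ Qc]; last by apply: Pb => //; rewrite bE dvdp_mulr.
  by apply: leq_trans szb; rewrite bE mulrC size_ltn_mul // irrP.1.
rewrite bE (derM der_ev0_poly) dvdp_add //; first exact: dvdp_mul.
by apply: dvdp_mul => //; apply: Pb => //; rewrite bE dvdp_mull.
Qed.

(** Induction on the denominator. A correction at [P] is replaced by its polar part there, so that
    its derivative adds no pole elsewhere and all powers of [P] leave the denominator. *)
Lemma remove_normal_poles f :
  (forall P, irreducible_poly P -> ~~ (P %| Dp P) -> exists h, locring ev0 P (f - D h)) ->
  exists g a b, [/\ b != 0, f - D g = ev0 a / ev0 b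
    & forall P, irreducible_poly P -> P %| b -> P %| Dp P].
Proof.
have nz p : p != 0 -> ev0 p != 0 by rewrite (ev_eq0 ev0_inj).
have [a [b [b0 fE]]] := ev0_fracs f.
have [n] := ubnP (size b); elim: n a b b0 f fE => // n IH a b b0 f fE.
rewrite ltnS => szb fP.
have [allS|/existsNP [P /not_implyP [irrP /not_implyP [Pb /negP nP]]]] :=
  pselect (forall P, irreducible_poly P -> P %| b -> P %| Dp P).
  by exists 0, a, b; rewrite (der0 hD) subr0.
have P0 := irredp_neq0 irrP.
have [h Oh] := fP P irrP nP.
have [l [b' [nb' bE]]] := irredp_mult irrP b0.
have b'0 : b' != 0 by apply: contraNneq nb' => ->; rewrite dvdp0.
have [p [q [q0 hE]]] := ev0_fracs h.
have [m [q' [nq' qE]]] := irredp_mult irrP q0.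
have q'0 : q' != 0 by apply: contraNneq nq' => ->; rewrite dvdp0.
have Pq' : coprimep (P ^+ m) q' by rewrite coprimep_expl // irredp_coprime.
have [[u v] /= uv1] := Bezout_eq1_coprimepP _ _ Pq'.
pose e := P ^+ m; have e0 : e != 0 by rewrite expf_neq0.
(* The polar part of [h] at [P]: the relation [u P^m + v q' = 1] gives [h - w = p u / q'], regular
   at [P]. *)
pose w := ev0 (p * v) / ev0 e.
have Ow : locring ev0 P (f - D w).
  have -> : f - D w = (f - D h) + D (h - w) by rewrite (derB hD); ring.
  apply: (locD ev0_inj irrP) => //; apply: (loc_der ev0_inj hD D_ev0 irrP).
  exists (p * u), q'; split=> //; rewrite hE qE /w -/e.
  have -> : ev0 p = ev0 (p * (u * e + v * q')) by rewrite uv1 mulr1.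
  by rewrite !(rmorphD, rmorphM) /=; field; rewrite !nz.
have [w1 [w2 [nw2 wE]]] := Ow.
have w20 : w2 != 0 by apply: contraNneq nw2 => ->; rewrite dvdp0.
pose S := Dp (p * v) * e - p * v * Dp e.
have fwE : f - D w = ev0 (a * e * e - S * (P ^+ l * b')) / ev0 (P ^+ l * b' * e * e).
  rewrite fE bE /w (der_div hD) ?nz // !D_ev0 /S.
  by rewrite !(rmorphB, rmorphM) /=; field; rewrite !nz // expf_neq0.
set N := a * e * e - _ in fwE.
have NE : N * w2 = w1 * (P ^+ l * b' * e * e).
  apply: ev0_inj; rewrite 2!rmorphM; apply/eqP; rewrite -eqr_div ?nz ?mulf_neq0 ?expf_neq0 //.
  by rewrite -fwE wE.
(* Regularity of [f - D w] at [P] makes every power of [P] in its denominator divide [N], since [w2]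
   is prime to [P]. Only [b'] remains below. *)
have [N' N'E] : exists N', N = N' * (P ^+ l * e * e).
  have co : coprimep (P ^+ l * e * e) w2 by rewrite /e -!exprD coprimep_expl // irredp_coprime.
  by apply/dvdpP; rewrite -(Gauss_dvdpl _ co) NE; apply/dvdpP; exists (w1 * b'); ring.
have [l0|l_gt0] := posnP l.
  by move: Pb; rewrite bE l0 expr0 mul1r (negPf nb').
have [|||g [a1 [b1 [b10 gE b1S]]]] := IH N' b' b'0 (f - D w).
- rewrite fwE N'E !rmorphM; field.
  by rewrite !nz // expf_neq0.
- apply: leq_trans szb; rewrite bE -(prednK l_gt0) exprS -mulrA.
  apply: leq_ltn_trans (size_ltn_mul irrP.1 _); last by rewrite mulf_neq0 ?expf_neq0.
  by apply: dvdp_leq; rewrite ?mulf_neq0 ?expf_neq0 ?dvdp_mull.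
- move=> P1 irrP1 nP1; have [h1 Oh1] := fP P1 irrP1 nP1; exists (h1 - w).
  by rewrite (derB hD) opprB addrA subrK.
by exists (w + g), a1, b1; split=> //; rewrite (derD hD) opprD addrA.
Qed.

End Stable.

(** * Rational functions as quotients of polynomials, and the conclusion *)

Lemma fraction_quotient (R : idomainType) (u : {fraction R}) :
  exists p q : R, q != 0 /\ u = FracField.tofrac p / FracField.tofrac q.
Proof.
elim/quotW: u => x; exists x.1, x.2; split; first exact: denom_ratioP.
have d0 : FracField.tofrac x.2 != 0 :> {fraction R} by rewrite tofrac_eq0 denom_ratioP.
apply: (mulIf d0); rewrite divfK //.
rewrite -[LHS]/(FracField.mul _ _); unlock FracField.tofrac; rewrite -FracField.pi_mul.
apply/eqmodP; rewrite /= FracField.equivfE /FracField.mulf.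
by rewrite !numden_Ratio ?mulf_neq0 ?oner_eq0 ?denom_ratioP // !mulr1 mulrC.
Qed.

Theorem theorem3p5 (F : fieldType) (d : F -> F) (D : ratfun F -> ratfun F) :
  is_derivation d ->
  [pchar F] =i pred0 ->
  (exists x : F, d x = 1) ->
  constants_alg_closed d ->
  monomial_ext d D ->
  same_constants d D ->
  forall f : ratfun F, stable_elem D f ->
  exists g : ratfun F, reduced D (f - D g).
Proof.
move=> hd /pcharf0P charF x_ex _ [hD [D_C [w D_X]]] constK f stab.
pose ev0 : {rmorphism {poly F} -> ratfun F} := @FracField.tofrac {poly F}.
have ev0_inj : injective ev0 by move=> p q /eqP; rewrite tofrac_eq => /eqP.
have ev0_fracs u : fracs ev0 u by have [p [q [q0 ->]]] := fraction_quotient u; exists p, q.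
have char0 n : n.+1%:R != 0 :> ratfun F.
  by rewrite -(rmorph_nat ev0) (ev_eq0 ev0_inj) -polyC_natr polyC_eq0 charF.
(* [D] preserves [F[t]] because it does so on [F] and sends [t] into [F[t]]. *)
have ex_Dp p : exists q, D (ev0 p) = ev0 q.
  elim/poly_ind: p => [|p c [q qE]]; first by exists 0; rewrite rmorph0 (der0 hD).
  exists (q * 'X + p * w + (d c)%:P).
  by rewrite !rmorphD !rmorphM (derD hD) (derM hD) qE [D (ev0 'X)]D_X [D (ev0 c%:P)]D_C.
have [Dp D_ev0] := choice ex_Dp.
have constK' u : D u = 0 -> exists c, u = ev0 c%:P by move=> /constK [c [_ ->]]; exists c.
have normal P := stable_normal_pole ev0_inj ev0_fracs char0 x_ex hD D_C constK' D_ev0 stab (P := P).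
have [g [a [b [b0 gE bS]]]] := remove_normal_poles ev0_inj ev0_fracs hD D_ev0 normal.
(* Dividing by the gcd gives lowest terms; irreducible factors of the new denominator still divide
   [b], so it remains special. *)
exists g; pose c := gcdp a b.
have c0 : c != 0 by rewrite gcdp_eq0 negb_and b0 orbT.
have aE : a = a %/ c * c by rewrite divpK // dvdp_gcdl.
have bE : b = b %/ c * c by rewrite divpK // dvdp_gcdr.
have bc0 : b %/ c != 0 by apply: contraNneq b0 => h; rewrite bE h mul0r.
exists (a %/ c), (b %/ c); split=> //; split; first by rewrite coprimep_div_gcd // b0 orbT.
split.
  rewrite gE {1}aE {1}bE !rmorphM -mulf_div divff ?mulr1 //.
  by rewrite (ev_eq0 ev0_inj).
exists (Dp (b %/ c)); split; first exact: D_ev0.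
rewrite /eqp dvdp_gcdl dvdp_gcd dvdpp /=.
apply: (dvdp_der_of_factors ev0_inj hD D_ev0 bc0) => P irrP Pbc.
by apply: bS => //; rewrite bE dvdp_mulr.
Qed.
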